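(* Let $\mathcal{S}$ be the family of univalent (i.e. one-to-one) holomorphic maps $f:D_1\to\mathbb{C}$ satisfying $f(0)=0$ and $f'(0)=1$. There exists a constant $b\in(1,\infty)$ such that for any $f\in\mathcal{S}$, the set $\Omega=f(D_1)$ has the property $$\frac1b\le \operatorname{dist}(0,\partial\Omega)\le 1.$$
   Context: $D_1$ is the open unit disk in $\mathbb{C}$, $\partial\Omega$ is the boundary of $\Omega$ in $\mathbb{C}$, and dist is Euclidean distance: $\operatorname{dist}(0,\partial\Omega)=\inf\{|z|:z\in\partial\Omega\}$. *)

(* Defs.v *)
From Stdlib Require Export Reals.
From Coquelicot Require Export Coquelicot.

Open Scope R_scope.

Definition unit_disk (z : C) : Prop := Cmod z < 1.

(* [ex_derive] over the absolute ring C is complex differentiability; on an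
   open set [D] it depends only on the values of [f] on [D]. *)
Definition holomorphic_on (D : C -> Prop) (f : C -> C) : Prop :=
  forall z : C, D z -> @ex_derive C_AbsRing C_NormedModule f z.

Definition injective_on (D : C -> Prop) (f : C -> C) : Prop :=
  forall z w : C, D z -> D w -> f z = f w -> z = w.

(* Maps D_1 -> C are represented by total functions [C -> C] whose values off
   the unit disk are irrelevant. *)
Definition class_S (f : C -> C) : Prop :=
  holomorphic_on unit_disk f /\
  injective_on unit_disk f /\
  f (RtoC 0) = RtoC 0 /\
  @is_derive C_AbsRing C_NormedModule f (RtoC 0) (RtoC 1).

Definition image (f : C -> C) (D : C -> Prop) (w : C) : Prop :=
  exists z : C, D z /\ f z = w.

(* [locally] on C is taken for the product uniform structure, whose topology is
   the Euclidean one. *)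
Definition boundary (A : C -> Prop) (z : C) : Prop :=
  forall N : C -> Prop, locally (T := C_UniformSpace) z N ->
    (exists w : C, N w /\ A w) /\ (exists w : C, N w /\ ~ A w).

(* The infimum is taken in the extended reals, so the distance to the empty set
   is [p_infty] rather than a junk real. *)
Definition dist_to (p : C) (A : C -> Prop) : Rbar :=
  Glb_Rbar (fun r : R => exists z : C, A z /\ r = Cmod (z - p)%C).

(* Main.v *)
Require Import Defs.
From Stdlib Require Import Reals Lra Lia IndefiniteDescription Classical_Prop.
From Coquelicot Require Import Coquelicot.

(** The proof rests on two weak consequences of Cauchy's theorem, the maximum
    modulus principle and the Cauchy estimate, applied to functions that are
    only assumed to be complex differentiable.

    Cauchy's theorem is proved for rectangles by bisection
    ([Cauchy_Goursat_rect]).  Applied to [h (exp z)] on a rectangle of height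
    [2 * PI], whose horizontal sides contribute equally by periodicity, it says
    that the mean of [h] over the circle of radius [r] does not depend on [r].
    Letting one radius tend to [0] gives [max_modulus], which needs
    differentiability of [h] only away from the centre: the singularity has been
    sent to infinity.  For this reason it applies to difference quotients
    and yields [Cauchy_estimate].

    Upper bound.  For [f] in the class, [z / f z] extends by [1] at the origin and
    has no other singularity, so by the maximum modulus principle every circle
    [|z| = r < 1] carries a point with [|f z| <= r].  As [r] tends to [1] these
    values accumulate at some [w] with [|w| <= 1], and [w] is not in the image:
    if [w = f zeta], then by the open mapping property a whole neighbourhood of
    [w] would be attained near [zeta], contradicting injectivity of [f] at the
    points near the unit circle.  So [w] is a boundary point.

    Lower bound, with [b = 512].  Suppose that [f] omits a small value [w].  After
    replacing [f z] by [2 * f (z / 2)] we may assume [|f| <= M].  The function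
    [1 - f (z / 2) / w] vanishes nowhere, so it has a square root [g], and
    [f1 = - 4 * w * (g - 1)] is again in the class ([koebe_transform]).  The square
    root makes the bound much better: [|f1|] is at most about
    [4 * sqrt (M * |w|)], hence at most [M / 2].  Moreover [f1] still omits a small
    value: as [g ^ 2] is injective, [g] never takes opposite values; so
    if [g] took all values near [1] it would stay away from [-1], and
    [1 / (1 + g)] would be bounded, which contradicts the Cauchy estimate as
    [g' 0 = - 1 / (4 * w)] is large.  Iterating, we obtain functions in the class
    with arbitrarily small bounds, whereas a bound for a function with derivative
    [1] at the origin is at least [1 / 2]. *)

(** * Continuity and differentiability of complex functions *)

Notation Ccontinuous := (@continuous C_UniformSpace C_UniformSpace).
Notation Cis_derive := (@is_derive C_AbsRing C_NormedModule).
Notation Clocally := (@locally C_UniformSpace).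

(** The product uniform structure of [C] measures squares rather than disks;
    all later estimates use the modulus, and this lemma and the next one
    translate. *)
Lemma Clocally_iff (z : C) (P : C -> Prop) :
  Clocally z P <->
  exists d : R, 0 < d /\ forall w : C, Cmod (w - z) < d -> P w.
Proof.
  split.
  - intros [d Hd]. exists d. split; [apply cond_pos|].
    intros w Hw. apply Hd. apply C_NormedModule_mixin_compat1. exact Hw.
  - intros [d [Hd H]].
    assert (H2 : 0 < sqrt 2) by (apply sqrt_lt_R0; lra).
    assert (Hd' : 0 < d / sqrt 2) by (apply Rdiv_lt_0_compat; lra).
    exists (mkposreal _ Hd'). intros w Hw. apply H.
    apply C_NormedModule_mixin_compat2 in Hw. simpl in Hw.
    replace (sqrt 2 * (d / sqrt 2)) with d in Hw by (field; lra).
    exact Hw.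
Qed.

Lemma Ccontinuous_iff (f : C -> C) (z : C) :
  Ccontinuous f z <->
  forall eps : R, 0 < eps -> exists d : R, 0 < d /\
    forall w : C, Cmod (w - z) < d -> Cmod (f w - f z) < eps.
Proof.
  split.
  - intros H eps Heps. apply (Clocally_iff z (fun w => Cmod (f w - f z) < eps)).
    apply (H (fun y : C => Cmod (y - f z) < eps)).
    apply Clocally_iff. exists eps. auto.
  - intros H P HP. apply Clocally_iff in HP. destruct HP as [e [He HP]].
    destruct (H e He) as [d [Hd Hw]].
    apply (Clocally_iff z (fun w => P (f w))).
    exists d. split; [exact Hd|]. intros w Hlt. apply HP, Hw, Hlt.
Qed.

Lemma Cmod_minus_sym (z w : C) : Cmod (z - w) = Cmod (w - z).
Proof. rewrite <- Cmod_opp. f_equal. ring. Qed.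

Lemma Cmod_minus_le (z w : C) : Cmod z - Cmod w <= Cmod (z - w).
Proof.
  pose proof (Cmod_triangle (z - w) w) as H.
  replace (z - w + w)%C with z in H by ring. lra.
Qed.

Lemma Ccontinuous_mult (f g : C -> C) (z : C) :
  Ccontinuous f z -> Ccontinuous g z -> Ccontinuous (fun w => f w * g w)%C z.
Proof.
  intros Hf Hg P HP. apply locally_C in HP. revert P HP.
  refine (continuous_mult (K := C_AbsRing) f g z _ _);
  intros P HP; apply locally_C in HP; auto.
Qed.

Lemma Ccontinuous_plus (f g : C -> C) (z : C) :
  Ccontinuous f z -> Ccontinuous g z -> Ccontinuous (fun w => f w + g w)%C z.
Proof. apply (continuous_plus (V := C_R_NormedModule) f g z). Qed.

Lemma Ccontinuous_inv (f : C -> C) (z : C) :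
  Ccontinuous f z -> f z <> 0 -> Ccontinuous (fun w => / f w)%C z.
Proof.
  intros Hf Hz. apply Ccontinuous_iff. intros eps Heps.
  rewrite Ccontinuous_iff in Hf.
  apply Cmod_gt_0 in Hz. set (m := Cmod (f z)) in *.
  destruct (Hf (Rmin (m / 2) (eps * m * m / 2))) as [d [Hd H]].
  { apply Rmin_pos; [lra|].
    apply Rdiv_lt_0_compat; [|lra]. apply Rmult_lt_0_compat; [|exact Hz].
    apply Rmult_lt_0_compat; assumption. }
  exists d. split; [exact Hd|]. intros w Hw. specialize (H w Hw).
  pose proof (Rmin_l (m / 2) (eps * m * m / 2)).
  pose proof (Rmin_r (m / 2) (eps * m * m / 2)).
  pose proof (Cmod_minus_le (f z) (f w)) as Hm.
  rewrite Cmod_minus_sym in Hm. fold m in Hm.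
  assert (Hfw : f w <> 0) by (apply Cmod_gt_0; lra).
  assert (Hfz : f z <> 0) by (apply Cmod_gt_0; exact Hz).
  replace (/ f w - / f z)%C with (- (f w - f z) / (f w * f z))%C
    by (field; auto).
  rewrite Cmod_div by (apply Cmult_neq_0; assumption).
  rewrite Cmod_opp, Cmod_mult. fold m.
  assert (Hp : 0 < Cmod (f w) * m) by (apply Rmult_lt_0_compat; lra).
  apply (Rmult_lt_reg_r (Cmod (f w) * m)); [exact Hp|].
  unfold Rdiv. rewrite Rmult_assoc, Rinv_l by (apply Rgt_not_eq; exact Hp).
  assert (0 < eps * m * (Cmod (f w) - m / 2))
    by (apply Rmult_lt_0_compat; [apply Rmult_lt_0_compat; assumption|lra]).
  lra.
Qed.

Lemma Ccontinuous_const (c z : C) : Ccontinuous (fun _ => c) z.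
Proof. apply continuous_const. Qed.

Lemma Ccontinuous_id (z : C) : Ccontinuous (fun w => w) z.
Proof. apply continuous_id. Qed.

Lemma Ccontinuous_comp (f g : C -> C) (z : C) :
  Ccontinuous f z -> Ccontinuous g (f z) -> Ccontinuous (fun w => g (f w)) z.
Proof. apply continuous_comp. Qed.

Lemma Ccontinuous_opp (f : C -> C) (z : C) :
  Ccontinuous f z -> Ccontinuous (fun w => - f w)%C z.
Proof. apply (continuous_opp (V := C_R_NormedModule) f z). Qed.

Lemma Ccontinuous_minus (f g : C -> C) (z : C) :
  Ccontinuous f z -> Ccontinuous g z -> Ccontinuous (fun w => f w - g w)%C z.
Proof. apply (continuous_minus (V := C_R_NormedModule) f g z). Qed.

Lemma Ccontinuous_ext_loc (f g : C -> C) (z : C) :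
  Clocally z (fun w => g w = f w) -> Ccontinuous g z -> Ccontinuous f z.
Proof. apply continuous_ext_loc. Qed.

(** The difference quotient completed by [l] at its singular point.  By
    Caratheodory's criterion [f] has derivative [l] at [z] exactly when this
    function is continuous at [z]; the rules of differentiation then reduce to
    algebraic identities between quotients. *)
Definition diff_quot (f : C -> C) (z l w : C) : C :=
  if Ceq_dec w z then l else ((f w - f z) / (w - z))%C.

Lemma diff_quot_spec (f : C -> C) (z l w : C) :
  (f w - f z = diff_quot f z l w * (w - z))%C.
Proof.
  unfold diff_quot. destruct (Ceq_dec w z) as [->|Hn]; [ring|].
  field. apply Cminus_eq_contra, Hn.
Qed.

Lemma diff_quot_at (f : C -> C) (z l : C) : diff_quot f z l z = l.
Proof. unfold diff_quot. destruct (Ceq_dec z z); congruence. Qed.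

Lemma Cis_derive_estimate (f : C -> C) (z l : C) :
  Cis_derive f z l <->
  forall eps : R, 0 < eps -> exists d : R, 0 < d /\ forall w : C,
    Cmod (w - z) < d ->
    Cmod (f w - f z - l * (w - z)) <= eps * Cmod (w - z).
Proof.
  split.
  - intros [_ H] eps Heps.
    assert (Hz : is_filter_lim (locally (T := AbsRing_UniformSpace C_AbsRing) z) z)
      by (intros P HP; exact HP).
    specialize (H z Hz (mkposreal _ Heps)).
    apply locally_C in H. apply Clocally_iff in H.
    destruct H as [d [Hd H]]. exists d. split; [exact Hd|].
    intros w Hw. specialize (H w Hw).
    change (Cmod (f w - f z - (w - z) * l) <= eps * Cmod (w - z)) in H.
    rewrite (Cmult_comm l). exact H.
  - intros H. split.
    + apply is_linear_scal_l.
    + intros x Hx eps.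
      apply (is_filter_lim_locally_unique
        (V := AbsRing_NormedModule C_AbsRing) z x) in Hx.
      subst x.
      apply locally_C. apply Clocally_iff.
      destruct (H eps (cond_pos eps)) as [d [Hd Hw]].
      exists d. split; [exact Hd|]. intros w Hlt.
      change (Cmod (f w - f z - (w - z) * l) <= eps * Cmod (w - z)).
      rewrite (Cmult_comm (w - z)). apply Hw, Hlt.
Qed.

Lemma diff_quot_continuous (f : C -> C) (z l : C) :
  Cis_derive f z l -> Ccontinuous (diff_quot f z l) z.
Proof.
  intros H. apply Ccontinuous_iff. intros eps Heps.
  destruct (proj1 (Cis_derive_estimate f z l) H (eps / 2)) as [d [Hd Hw]];
    [lra|].
  exists d. split; [exact Hd|]. intros w Hlt. rewrite diff_quot_at.
  unfold diff_quot. destruct (Ceq_dec w z) as [->|Hn].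
  - replace (l - l)%C with (RtoC 0) by ring. rewrite Cmod_0. exact Heps.
  - assert (Hn' : (w - z)%C <> 0) by (apply Cminus_eq_contra, Hn).
    specialize (Hw w Hlt).
    replace ((f w - f z) / (w - z) - l)%C
      with ((f w - f z - l * (w - z)) / (w - z))%C by (field; exact Hn').
    rewrite Cmod_div by exact Hn'. apply Cmod_gt_0 in Hn'.
    apply Rle_lt_trans with (eps / 2); [|lra].
    apply Rle_div_l; lra.
Qed.

Lemma Cis_derive_caratheodory (f q : C -> C) (z : C) :
  Ccontinuous q z ->
  Clocally z (fun w => f w - f z = q w * (w - z))%C ->
  Cis_derive f z (q z).
Proof.
  intros Hq Hloc. apply Cis_derive_estimate. intros eps Heps.
  destruct (proj1 (Ccontinuous_iff q z) Hq eps Heps) as [d1 [Hd1 H1]].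
  apply Clocally_iff in Hloc. destruct Hloc as [d2 [Hd2 H2]].
  exists (Rmin d1 d2). split; [apply Rmin_pos; assumption|].
  intros w Hw.
  specialize (H1 w (Rlt_le_trans _ _ _ Hw (Rmin_l _ _))).
  rewrite (H2 w (Rlt_le_trans _ _ _ Hw (Rmin_r _ _))).
  replace (q w * (w - z) - q z * (w - z))%C with ((q w - q z) * (w - z))%C
    by ring.
  rewrite Cmod_mult. apply Rmult_le_compat_r; [apply Cmod_ge_0|lra].
Qed.

Lemma Cis_derive_unpack (f : C -> C) (z l : C) :
  Cis_derive f z l -> exists q : C -> C, Ccontinuous q z /\ q z = l /\
    forall w : C, (f w = f z + q w * (w - z))%C.
Proof.
  intros H. exists (diff_quot f z l). split; [|split].
  - apply diff_quot_continuous, H.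
  - apply diff_quot_at.
  - intros w. rewrite <- diff_quot_spec. ring.
Qed.

Lemma Cis_derive_continuous (f : C -> C) (z l : C) :
  Cis_derive f z l -> Ccontinuous f z.
Proof.
  intros H. destruct (Cis_derive_unpack f z l H) as [q [Hq [_ E]]].
  apply Ccontinuous_ext_loc with (fun w => f z + q w * (w - z))%C.
  - apply filter_forall. intros w. symmetry. apply E.
  - apply Ccontinuous_plus; [apply Ccontinuous_const|].
    apply Ccontinuous_mult; [exact Hq|].
    apply Ccontinuous_minus; [apply Ccontinuous_id|apply Ccontinuous_const].
Qed.

Lemma Cis_derive_eq (f : C -> C) (z l l' : C) :
  Cis_derive f z l -> l = l' -> Cis_derive f z l'.
Proof. intros H <-. exact H. Qed.

Lemma Cis_derive_comp (f g : C -> C) (z lf lg : C) :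
  Cis_derive f z lf -> Cis_derive g (f z) lg ->
  Cis_derive (fun w => g (f w)) z (lg * lf)%C.
Proof.
  intros Hf Hg. pose proof (Cis_derive_continuous f z lf Hf) as Cf.
  destruct (Cis_derive_unpack f z lf Hf) as [p [Hp [<- Ef]]].
  destruct (Cis_derive_unpack g (f z) lg Hg) as [q [Hq [<- Eg]]].
  apply (Cis_derive_caratheodory (fun w => g (f w))
    (fun w => q (f w) * p w)%C z).
  - apply Ccontinuous_mult; [|exact Hp]. apply Ccontinuous_comp; assumption.
  - apply filter_forall. intros w. rewrite (Eg (f w)) at 1. rewrite (Ef w) at 2.
    ring.
Qed.

Lemma Cis_derive_plus (f g : C -> C) (z lf lg : C) :
  Cis_derive f z lf -> Cis_derive g z lg ->
  Cis_derive (fun w => f w + g w)%C z (lf + lg)%C.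
Proof. apply (is_derive_plus (V := C_NormedModule) f g z lf lg). Qed.

Lemma Cis_derive_const (c z : C) : Cis_derive (fun _ => c) z (RtoC 0).
Proof. apply (is_derive_const (V := C_NormedModule) c z). Qed.

Lemma Cis_derive_id (z : C) : Cis_derive (fun w => w) z (RtoC 1).
Proof.
  apply (Cis_derive_caratheodory (fun w => w) (fun _ => RtoC 1)).
  - apply Ccontinuous_const.
  - apply filter_forall. intros w. ring.
Qed.

Lemma Cis_derive_mult (f g : C -> C) (z lf lg : C) :
  Cis_derive f z lf -> Cis_derive g z lg ->
  Cis_derive (fun w => f w * g w)%C z (lf * g z + f z * lg)%C.
Proof.
  intros Hf Hg. pose proof (Cis_derive_continuous f z lf Hf) as Cf.
  destruct (Cis_derive_unpack f z lf Hf) as [p [Hp [<- Ef]]].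
  destruct (Cis_derive_unpack g z lg Hg) as [q [Hq [<- Eg]]].
  apply (Cis_derive_caratheodory (fun w => f w * g w)%C
    (fun w => p w * g z + f w * q w)%C z).
  - apply Ccontinuous_plus; apply Ccontinuous_mult;
      auto using Ccontinuous_const.
  - apply filter_forall. intros w. rewrite (Eg w). rewrite (Ef w). ring.
Qed.

Lemma Clocally_neq (f : C -> C) (z c : C) :
  Ccontinuous f z -> f z <> c -> Clocally z (fun w => f w <> c).
Proof.
  intros Cf Hz. apply (Cf (fun y => y <> c)). apply Clocally_iff.
  exists (Cmod (f z - c)). split; [apply Cmod_gt_0, Cminus_eq_contra, Hz|].
  intros w Hw ->. rewrite Cmod_minus_sym in Hw. lra.
Qed.

Lemma Cis_derive_inv (f : C -> C) (z l : C) :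
  Cis_derive f z l -> f z <> 0 ->
  Cis_derive (fun w => / f w)%C z (- l / (f z * f z))%C.
Proof.
  intros Hf Hz. pose proof (Cis_derive_continuous f z l Hf) as Cf.
  destruct (Cis_derive_unpack f z l Hf) as [q [Hq [<- E]]].
  apply (Cis_derive_caratheodory (fun w => / f w)%C
    (fun w => - q w / (f w * f z))%C z).
  - apply Ccontinuous_mult; [apply Ccontinuous_opp, Hq|].
    apply (Ccontinuous_inv (fun w => f w * f z)%C).
    + apply Ccontinuous_mult; auto using Ccontinuous_const.
    + apply Cmult_neq_0; exact Hz.
  - generalize (Clocally_neq f z 0 Cf Hz). apply filter_imp. intros w Hw.
    assert (Eq : (q w * (w - z) = f w - f z)%C) by (rewrite (E w) at 1; ring).
    replace (- q w / (f w * f z) * (w - z))%C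
      with (- (q w * (w - z)) / (f w * f z))%C by (field; auto).
    rewrite Eq. field. auto.
Qed.

(** A continuous branch of the square root of a differentiable function is
    differentiable, because
    [g w - g z = (h w - h z) / (g w + g z)]. *)
Lemma Cis_derive_sqrt (g h : C -> C) (z l : C) :
  Ccontinuous g z -> g z <> 0 -> Clocally z (fun w => g w * g w = h w)%C ->
  Cis_derive h z l -> Cis_derive g z (l / (2 * g z))%C.
Proof.
  intros Cg Hz Hsq Hh.
  destruct (Cis_derive_unpack h z l Hh) as [q [Hq [<- E]]].
  assert (H2 : (2 * g z)%C <> 0).
  { apply Cmult_neq_0; [|exact Hz]. intros H. apply RtoC_inj in H. lra. }
  assert (Cs : Ccontinuous (fun w => g w + g z)%C z)
    by (apply Ccontinuous_plus; auto using Ccontinuous_const).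
  assert (Hs : (g z + g z)%C <> 0)
    by (replace (g z + g z)%C with (2 * g z)%C by ring; exact H2).
  replace (q z / (2 * g z))%C with (q z / (g z + g z))%C
    by (replace (2 * g z)%C with (g z + g z)%C by ring; reflexivity).
  apply (Cis_derive_caratheodory g (fun w => q w / (g w + g z))%C z).
  - apply Ccontinuous_mult; [exact Hq|].
    apply (Ccontinuous_inv (fun w => g w + g z)%C); assumption.
  - pose proof (locally_singleton z _ Hsq) as Hzz. simpl in Hzz.
    generalize (filter_and _ _ Hsq (Clocally_neq _ z 0 Cs Hs)).
    apply filter_imp. intros w [Hw Hn].
    assert (Eq : (q w * (w - z) = g w * g w - g z * g z)%C)
      by (rewrite Hw, Hzz, (E w); ring).
    replace (q w / (g w + g z) * (w - z))%C
      with ((q w * (w - z)) / (g w + g z))%C by (field; exact Hn).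
    rewrite Eq. field. exact Hn.
Qed.

(** * Integrals along the sides of a rectangle *)

Notation CInt f a b := (RInt (V := C_R_CompleteNormedModule) f a b).
Notation ex_CInt f a b := (ex_RInt (V := C_R_NormedModule) f a b).

(** The norm of [C] as a real normed module is built from the norms of the two
    components. *)
Lemma norm_C_R (z : C) : @norm R_AbsRing C_R_NormedModule z = Cmod z.
Proof.
  unfold norm; simpl. unfold prod_norm, Cmod, norm; simpl. unfold abs; simpl.
  f_equal. rewrite !Rmult_1_r.
  rewrite <- !Rabs_mult, !Rabs_pos_eq by apply Rle_0_sqr. reflexivity.
Qed.

Lemma CInt_near_const (F : R -> C) (a b : R) (K : C) (eta : R) :
  a <= b -> ex_CInt F a b ->
  (forall x : R, a <= x <= b -> Cmod (F x - K) <= eta) ->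
  Cmod (CInt F a b - (b - a)%R * K) <= (b - a) * eta.
Proof.
  intros Hab HF H.
  rewrite <- norm_C_R.
  apply (norm_RInt_le_const (V := C_R_NormedModule) (fun x => F x - K)%C a b).
  - exact Hab.
  - intros x Hx. rewrite norm_C_R. apply H, Hx.
  - apply (is_RInt_minus (V := C_R_NormedModule) F (fun _ => K)).
    + apply (RInt_correct (V := C_R_CompleteNormedModule)), HF.
    + replace ((b - a)%R * K)%C with (scal (V := C_R_ModuleSpace) (b - a) K)
        by apply scal_R_Cmult.
      apply (is_RInt_const (V := C_R_NormedModule)).
Qed.

Definition in_rect (a b c d : R) (z : C) : Prop :=
  a <= Re z <= b /\ c <= Im z <= d.

(** The integral of [H] along the boundary of a rectangle, with opposite sides
    grouped so that the contribution of a constant cancels under the integral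
    sign. *)
Definition rect_int (H : C -> C) (a b c d : R) : C :=
  (CInt (fun x => H (x, c) - H (x, d))%C a b
   + Ci * CInt (fun y => H (b, y) - H (a, y))%C c d)%C.

Lemma continuous_hor (c x : R) :
  @continuous R_UniformSpace C_UniformSpace (fun x => (x, c)) x.
Proof.
  intros P [d Hd]. exists d. intros y Hy. apply Hd. split; [exact Hy|].
  apply ball_center.
Qed.

Lemma continuous_ver (a y : R) :
  @continuous R_UniformSpace C_UniformSpace (fun y => (a, y)) y.
Proof.
  intros P [d Hd]. exists d. intros z Hz. apply Hd. split; [|exact Hz].
  apply ball_center.
Qed.

Lemma ex_CInt_continuous (F : R -> C) (a b : R) :
  a <= b ->
  (forall x, a <= x <= b -> @continuous R_UniformSpace C_UniformSpace F x) ->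
  ex_CInt F a b.
Proof.
  intros Hab HF. apply (ex_RInt_continuous (V := C_R_CompleteNormedModule)).
  intros x Hx. rewrite Rmin_left, Rmax_right in Hx by exact Hab.
  apply HF, Hx.
Qed.

Section Rectangle.

Variables (H : C -> C) (a b c d : R).
Hypothesis Hab : a <= b.
Hypothesis Hcd : c <= d.
Hypothesis HH : forall z, in_rect a b c d z -> Ccontinuous H z.

Lemma ex_CInt_hor (y : R) : c <= y <= d -> ex_CInt (fun x => H (x, y)) a b.
Proof.
  intros Hy. apply ex_CInt_continuous; [exact Hab|].
  intros x Hx. apply (continuous_comp (fun x => (x, y)) H).
  - apply continuous_hor.
  - apply HH. split; assumption.
Qed.

Lemma ex_CInt_ver (x : R) : a <= x <= b -> ex_CInt (fun y => H (x, y)) c d.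
Proof.
  intros Hx. apply ex_CInt_continuous; [exact Hcd|].
  intros y Hy. apply (continuous_comp (fun y => (x, y)) H).
  - apply continuous_ver.
  - apply HH. split; assumption.
Qed.

Lemma ex_CInt_hor_diff :
  ex_CInt (fun x => H (x, c) - H (x, d))%C a b.
Proof.
  apply (ex_RInt_minus (V := C_R_NormedModule)); apply ex_CInt_hor; lra.
Qed.

Lemma ex_CInt_ver_diff (x1 x2 : R) : a <= x1 <= b -> a <= x2 <= b ->
  ex_CInt (fun y => H (x2, y) - H (x1, y))%C c d.
Proof.
  intros H1 H2.
  apply (ex_RInt_minus (V := C_R_NormedModule)); apply ex_CInt_ver; lra.
Qed.

(** The boundary integral of an affine function vanishes, so only the distance
    from [H] to its affine approximation contributes. *)
Lemma rect_int_affine (z0 l : C) (eta : R) :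
  (forall z, in_rect a b c d z -> Cmod (H z - H z0 - l * (z - z0)) <= eta) ->
  Cmod (rect_int H a b c d) <= 2 * eta * ((b - a) + (d - c)).
Proof.
  intros HE.
  set (K1 := (l * (- (Ci * (d - c)%R)))%C). set (K2 := (l * (b - a)%R)%C).
  assert (E1 : forall x, a <= x <= b ->
    Cmod (H (x, c) - H (x, d) - K1) <= 2 * eta).
  { intros x Hx.
    assert (Hc := HE (x, c) (conj Hx (conj (Rle_refl c) Hcd))).
    assert (Hd := HE (x, d) (conj Hx (conj Hcd (Rle_refl d)))).
    replace (H (x, c) - H (x, d) - K1)%C
      with ((H (x, c) - H z0 - l * ((x, c) - z0))
            + - (H (x, d) - H z0 - l * ((x, d) - z0)))%C.
    - eapply Rle_trans; [apply Cmod_triangle|]. rewrite Cmod_opp. lra.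
    - unfold K1.
      replace ((x, c) : C) with (x + Ci * c)%C
        by (unfold Ci, RtoC, Cplus, Cmult; simpl; f_equal; ring).
      replace ((x, d) : C) with (x + Ci * d)%C
        by (unfold Ci, RtoC, Cplus, Cmult; simpl; f_equal; ring).
      rewrite RtoC_minus. ring. }
  assert (E2 : forall y, c <= y <= d ->
    Cmod (H (b, y) - H (a, y) - K2) <= 2 * eta).
  { intros y Hy.
    assert (Hb := HE (b, y) (conj (conj Hab (Rle_refl b)) Hy)).
    assert (Ha := HE (a, y) (conj (conj (Rle_refl a) Hab) Hy)).
    replace (H (b, y) - H (a, y) - K2)%C
      with ((H (b, y) - H z0 - l * ((b, y) - z0))
            + - (H (a, y) - H z0 - l * ((a, y) - z0)))%C.
    - eapply Rle_trans; [apply Cmod_triangle|]. rewrite Cmod_opp. lra.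
    - unfold K2.
      replace ((b, y) : C) with (b + Ci * y)%C
        by (unfold Ci, RtoC, Cplus, Cmult; simpl; f_equal; ring).
      replace ((a, y) : C) with (a + Ci * y)%C
        by (unfold Ci, RtoC, Cplus, Cmult; simpl; f_equal; ring).
      rewrite RtoC_minus. ring. }
  apply CInt_near_const in E1; [|exact Hab|exact ex_CInt_hor_diff].
  apply CInt_near_const in E2; [|exact Hcd|apply ex_CInt_ver_diff; lra].
  unfold rect_int.
  set (I1 := CInt _ a b) in *. set (I2 := CInt _ c d) in *.
  replace (I1 + Ci * I2)%C
    with ((I1 - (b - a)%R * K1) + Ci * (I2 - (d - c)%R * K2))%C
    by (unfold K1, K2; ring).
  eapply Rle_trans; [apply Cmod_triangle|].
  rewrite Cmod_mult, Cmod_Ci. lra.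
Qed.

Lemma rect_int_split_hor (m : R) : a <= m <= b ->
  (rect_int H a b c d = rect_int H a m c d + rect_int H m b c d)%C.
Proof.
  intros Hm. unfold rect_int.
  rewrite <- (RInt_Chasles (V := C_R_CompleteNormedModule) _ a m b).
  2:{ apply ex_RInt_Chasles_1 with b; [exact Hm|exact ex_CInt_hor_diff]. }
  2:{ apply ex_RInt_Chasles_2 with a; [exact Hm|exact ex_CInt_hor_diff]. }
  assert (E : CInt (fun y => H (b, y) - H (a, y))%C c d =
    (CInt (fun y => H (m, y) - H (a, y))%C c d
     + CInt (fun y => H (b, y) - H (m, y))%C c d)%C).
  { etransitivity; [|apply (RInt_plus (V := C_R_CompleteNormedModule));
                     apply ex_CInt_ver_diff; lra].
    apply RInt_ext. intros y _.
    change (H (b, y) - H (a, y)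
            = (H (m, y) - H (a, y)) + (H (b, y) - H (m, y)))%C. ring. }
  rewrite E. change plus with Cplus. simpl. ring.
Qed.

Lemma rect_int_split_ver (m : R) : c <= m <= d ->
  (rect_int H a b c d = rect_int H a b c m + rect_int H a b m d)%C.
Proof.
  intros Hm. unfold rect_int.
  rewrite <- (RInt_Chasles (V := C_R_CompleteNormedModule) _ c m d).
  2:{ apply ex_RInt_Chasles_1 with d; [exact Hm|apply ex_CInt_ver_diff; lra]. }
  2:{ apply ex_RInt_Chasles_2 with c; [exact Hm|apply ex_CInt_ver_diff; lra]. }
  assert (E : CInt (fun x => H (x, c) - H (x, d))%C a b =
    (CInt (fun x => H (x, c) - H (x, m))%C a b
     + CInt (fun x => H (x, m) - H (x, d))%C a b)%C).
  { etransitivity; [|apply (RInt_plus (V := C_R_CompleteNormedModule));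
                     apply (ex_RInt_minus (V := C_R_NormedModule));
                     apply ex_CInt_hor; lra].
    apply RInt_ext. intros x _.
    change (H (x, c) - H (x, d)
            = (H (x, c) - H (x, m)) + (H (x, m) - H (x, d)))%C. ring. }
  rewrite E. change plus with Cplus. simpl. ring.
Qed.

End Rectangle.

(** * The Cauchy-Goursat theorem for rectangles *)

Lemma nested_intervals (u v : nat -> R) :
  (forall n, u n <= u (S n)) -> (forall n, v (S n) <= v n) ->
  (forall n, u n <= v n) -> exists X, forall n, u n <= X <= v n.
Proof.
  intros Hu Hv Huv.
  assert (Gu : forall n m, (n <= m)%nat -> u n <= u m)
    by (intros n m L; induction L; [lra|eapply Rle_trans; eauto]).
  assert (Gv : forall n m, (n <= m)%nat -> v m <= v n)
    by (intros n m L; induction L; [lra|eapply Rle_trans; eauto]).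
  assert (B : forall n m, u n <= v m).
  { intros n m. apply Rle_trans with (u (max n m)); [apply Gu; lia|].
    eapply Rle_trans; [apply Huv|apply Gv; lia]. }
  destruct (completeness (fun x => exists n, x = u n)) as [X [H1 H2]].
  - exists (v O). intros x [n ->]. apply B.
  - exists (u O). exists O. reflexivity.
  - exists X. intros n. split.
    + apply H1. exists n. reflexivity.
    + apply H2. intros x [m ->]. apply B.
Qed.

(** Repeated halving of a box of shape [p] by [q].  The limit point lies in all
    the selected boxes and not merely near them: the differentiability
    estimate at that point, multiplied by the perimeter, is then quadratic in the
    size of the box. *)
Lemma bisection (p q : R) (P : R -> R -> R -> Prop) (x0 y0 : R) :
  0 <= p -> 0 <= q ->
  (forall x y s, 0 < s -> P x y s ->
    exists x' y', P x' y' (s / 2) /\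
      x <= x' /\ x' + p * (s / 2) <= x + p * s /\
      y <= y' /\ y' + q * (s / 2) <= y + q * s) ->
  P x0 y0 1 ->
  exists X Y, forall e, 0 < e -> exists x y s, 0 < s < e /\ P x y s /\
    x <= X <= x + p * s /\ y <= Y <= y + q * s.
Proof.
  intros Hp Hq Hstep H0.
  (* The state is a box together with its scale; states that violate
     the hypotheses are sent to an arbitrary value. *)
  destruct (functional_choice (fun t t' : R * R * R =>
    let '(x, y, s) := t in let '(x', y', s') := t' in
    0 < s -> P x y s -> s' = s / 2 /\ P x' y' s' /\
      x <= x' /\ x' + p * s' <= x + p * s /\
      y <= y' /\ y' + q * s' <= y + q * s)) as [f Hf].
  { intros [[x y] s].
    destruct (Classical_Prop.classic (0 < s /\ P x y s)) as [[Hs HP]|Hn].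
    - destruct (Hstep x y s Hs HP) as [x' [y' H]].
      exists (x', y', s / 2). intros _ _. split; [reflexivity|exact H].
    - exists (0, 0, 0). intros Hs HP. exfalso. auto. }
  set (t := fix t n := match n with O => (x0, y0, 1) | S n => f (t n) end).
  set (X := fun n => fst (fst (t n))). set (Y := fun n => snd (fst (t n))).
  set (S' := fun n => snd (t n)).
  assert (Inv : forall n, 0 < S' n /\ P (X n) (Y n) (S' n) /\
    S' n = (/ 2) ^ n).
  { induction n as [|n [IH1 [IH2 IH3]]]; unfold X, Y, S' in *; simpl.
    - split; [lra|]. split; [exact H0|reflexivity].
    - specialize (Hf (t n)). destruct (t n) as [[x y] s]. simpl in *.
      destruct (f (x, y, s)) as [[x' y'] s']. simpl.
      destruct (Hf IH1 IH2) as [-> [HP _]].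
      split; [lra|]. split; [exact HP|]. rewrite IH3. field. }
  assert (Nest : forall n,
    X n <= X (S n) /\ X (S n) + p * S' (S n) <= X n + p * S' n /\
    Y n <= Y (S n) /\ Y (S n) + q * S' (S n) <= Y n + q * S' n).
  { intros n. destruct (Inv n) as [I1 [I2 _]]. unfold X, Y, S' in *; simpl.
    specialize (Hf (t n)). destruct (t n) as [[x y] s]. simpl in *.
    destruct (f (x, y, s)) as [[x' y'] s']. simpl.
    destruct (Hf I1 I2) as [_ [_ H]]. exact H. }
  assert (Pos : forall n, 0 <= p * S' n /\ 0 <= q * S' n).
  { intros n. destruct (Inv n) as [I _].
    split; apply Rmult_le_pos; lra. }
  destruct (nested_intervals X (fun n => X n + p * S' n)) as [X' HX].
  1-3: intros n; pose proof (Nest n); pose proof (Pos n); lra.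
  destruct (nested_intervals Y (fun n => Y n + q * S' n)) as [Y' HY].
  1-3: intros n; pose proof (Nest n); pose proof (Pos n); lra.
  exists X', Y'. intros e He.
  destruct (pow_lt_1_zero (/ 2)) with (y := e) as [N HN];
    [rewrite Rabs_pos_eq; lra|exact He|].
  destruct (Inv N) as [I1 [I2 I3]].
  exists (X N), (Y N), (S' N). split; [split; [exact I1|]|].
  - specialize (HN N (le_n N)). rewrite Rabs_pos_eq in HN; rewrite I3 in *; lra.
  - auto.
Qed.

Lemma Cmod_le_Rabs (z : C) : Cmod z <= Rabs (Re z) + Rabs (Im z).
Proof.
  replace z with (Re z + Ci * Im z)%C at 1
    by (destruct z; unfold Ci, RtoC, Cplus, Cmult; simpl; f_equal; ring).
  eapply Rle_trans; [apply Cmod_triangle|].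
  rewrite Cmod_mult, Cmod_Ci, !Cmod_R. lra.
Qed.

(** If the integral were not zero, quartering would lead to boxes of scale [s]
    whose integral exceeds a fixed multiple of [s * s], while differentiability at
    the point they shrink to makes it negligible with respect to [s * s]. *)
Theorem Cauchy_Goursat_rect (H : C -> C) (a b c d : R) :
  a <= b -> c <= d ->
  (forall z, in_rect a b c d z -> exists l, Cis_derive H z l) ->
  rect_int H a b c d = RtoC 0.
Proof.
  intros Hab Hcd HH.
  assert (HC : forall z, in_rect a b c d z -> Ccontinuous H z).
  { intros z Hz. destruct (HH z Hz) as [l Hl].
    exact (Cis_derive_continuous H z l Hl). }
  apply Cmod_eq_0. apply Rle_antisym; [|apply Cmod_ge_0].
  apply Rnot_lt_le. intros Hpos.
  set (J := Cmod (rect_int H a b c d)) in *.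
  set (p := b - a). set (q := d - c).
  destruct (bisection p q (fun x y s =>
    (a <= x /\ x + p * s <= b /\ c <= y /\ y + q * s <= d) /\
    J / 2 * (s * s) < Cmod (rect_int H x (x + p * s) y (y + q * s))) a c)
    as [X [Y HXY]].
  - unfold p; lra.
  - unfold q; lra.
  - intros x y s Hs [[H1 [H2 [H3 H4]]] HJ].
    assert (Hps : 0 <= p * s) by (apply Rmult_le_pos; unfold p; lra).
    assert (Hqs : 0 <= q * s) by (apply Rmult_le_pos; unfold q; lra).
    assert (Sub : forall z, in_rect x (x + p * s) y (y + q * s) z ->
      in_rect a b c d z) by (intros z [Z1 Z2]; split; lra).
    set (mx := x + p * (s / 2)). set (my := y + q * (s / 2)).
    assert (Hmx : mx + p * (s / 2) = x + p * s) by (unfold mx; field).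
    assert (Hmy : my + q * (s / 2) = y + q * s) by (unfold my; field).
    rewrite (rect_int_split_hor H x (x + p * s) y (y + q * s)) with (m := mx)
      in HJ; try (unfold mx; lra).
    2:{ intros z Hz; apply HC, Sub, Hz. }
    rewrite (rect_int_split_ver H x mx y (y + q * s)) with (m := my)
      in HJ; try (unfold mx, my; lra).
    2:{ intros z [Z1 Z2]; apply HC, Sub; split; unfold mx in *; lra. }
    rewrite (rect_int_split_ver H mx (x + p * s) y (y + q * s)) with (m := my)
      in HJ; try (unfold mx, my; lra).
    2:{ intros z [Z1 Z2]; apply HC, Sub; split; unfold mx in *; lra. }
    set (J1 := rect_int H x mx y my) in HJ.
    set (J2 := rect_int H x mx my (y + q * s)) in HJ.
    set (J3 := rect_int H mx (x + p * s) y my) in HJ.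
    set (J4 := rect_int H mx (x + p * s) my (y + q * s)) in HJ.
    pose proof (Cmod_triangle (J1 + J2) (J3 + J4)).
    pose proof (Cmod_triangle J1 J2). pose proof (Cmod_triangle J3 J4).
    set (k := J / 2 * (s / 2 * (s / 2))).
    assert (Hk : J / 2 * (s * s) = 4 * k) by (unfold k; field).
    destruct (Rlt_le_dec k (Cmod J1)) as [L1|L1];
      [|destruct (Rlt_le_dec k (Cmod J2)) as [L2|L2];
      [|destruct (Rlt_le_dec k (Cmod J3)) as [L3|L3]]].
    + exists x, y. fold mx my. repeat split; try (unfold mx, my; lra).
      exact L1.
    + exists x, my. fold mx. rewrite Hmy.
      repeat split; try (unfold mx, my; lra). exact L2.
    + exists mx, y. fold my. rewrite Hmx.
      repeat split; try (unfold mx, my; lra). exact L3.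
    + exists mx, my. rewrite Hmx, Hmy.
      repeat split; try (unfold mx, my; lra). fold J4 k. lra.
  - split; [unfold p, q; lra|].
    replace (a + p * 1) with b by (unfold p; ring).
    replace (c + q * 1) with d by (unfold q; ring). fold J. lra.
  - set (z0 := (X, Y) : C). set (L := p + q).
    assert (HL : 0 <= L) by (unfold L, p, q; lra).
    assert (Hz0 : in_rect a b c d z0).
    { destruct (HXY 1 Rlt_0_1) as [x [y [s [_ [[B _] [B1 B2]]]]]].
      split; simpl; lra. }
    destruct (HH z0 Hz0) as [l Hl].
    (* This [eps] makes the bound [2 * eps * (L * L) * (s * s)] smaller than
       [J / 2 * (s * s)]; the summand [1] covers a degenerate rectangle. *)
    set (eps := J / (8 * (L * L + 1))).
    assert (HLL : 0 <= L * L) by (apply Rmult_le_pos; exact HL).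
    assert (Heps : 0 < eps) by (apply Rdiv_lt_0_compat; lra).
    destruct (proj1 (Cis_derive_estimate H z0 l) Hl eps Heps) as [e [He E]].
    destruct (HXY (e / (L + 1))) as [x [y [s [[Hs1 Hs2] [[B HJ] [B1 B2]]]]]].
    { apply Rdiv_lt_0_compat; lra. }
    assert (HLs : L * s < e).
    { apply Rle_lt_trans with ((L + 1) * s); [lra|].
      apply (Rmult_lt_compat_l (L + 1)) in Hs2; [|lra].
      replace ((L + 1) * (e / (L + 1))) with e in Hs2 by (field; lra).
      exact Hs2. }
    apply (Rlt_irrefl (J / 2 * (s * s))).
    eapply Rlt_le_trans; [exact HJ|].
    eapply Rle_trans.
    { apply (rect_int_affine H x (x + p * s) y (y + q * s))
        with (z0 := z0) (l := l) (eta := eps * (L * s)); [lra|lra| |].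
      - intros z [Z1 Z2]. apply HC. split; lra.
      - intros z [Z1 Z2].
        assert (Hzz : Cmod (z - z0) <= L * s).
        { eapply Rle_trans; [apply Cmod_le_Rabs|]. unfold z0, L. simpl.
          unfold Re in Z1. unfold Im in Z2.
          assert (Rabs (fst z + - X) <= p * s) by (apply Rabs_le; lra).
          assert (Rabs (snd z + - Y) <= q * s) by (apply Rabs_le; lra).
          lra. }
        eapply Rle_trans; [apply E; lra|].
        apply Rmult_le_compat_l; lra. }
    replace (2 * (eps * (L * s)) * (x + p * s - x + (y + q * s - y)))
      with (2 * eps * (L * L) * (s * s)) by (unfold L; ring).
    apply Rmult_le_compat_r; [apply Rmult_le_pos; lra|].
    assert (Heq : J = 8 * eps * (L * L + 1)) by (unfold eps; field; lra).
    rewrite Heq at 1.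
    assert (0 <= eps * (L * L)) by (apply Rmult_le_pos; lra).
    lra.
Qed.

(** * The maximum modulus principle and the Cauchy estimate *)

Definition polar (r t : R) : C := (r * cos t, r * sin t).

Definition cexp (z : C) : C := polar (exp (Re z)) (Im z).

Lemma cexp_plus (z w : C) : cexp (z + w) = (cexp z * cexp w)%C.
Proof.
  destruct z as [x y], w as [x' y']. unfold cexp, polar, Cmult, Cplus, Re, Im. simpl.
  rewrite exp_plus, cos_plus, sin_plus. f_equal; ring.
Qed.

Lemma Cmod_polar (r t : R) : 0 <= r -> Cmod (polar r t) = r.
Proof.
  intros Hr. unfold Cmod, polar. simpl fst. simpl snd.
  replace ((r * cos t) ^ 2 + (r * sin t) ^ 2) with (r ^ 2).
  - rewrite sqrt_pow2; [reflexivity|exact Hr].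
  - pose proof (sin2_cos2 t) as E. unfold Rsqr in E.
    transitivity (r ^ 2 * (sin t * sin t + cos t * cos t));
      [rewrite E|]; ring.
Qed.

Lemma Cmod_cexp (z : C) : Cmod (cexp z) = exp (Re z).
Proof. apply Cmod_polar. left. apply exp_pos. Qed.

Lemma derivable_pt_lim_estimate (f : R -> R) (x l : R) :
  derivable_pt_lim f x l -> forall eps : R, 0 < eps ->
  exists d : R, 0 < d /\ forall h : R, Rabs h < d ->
    Rabs (f (x + h) - f x - l * h) <= eps * Rabs h.
Proof.
  intros H eps Heps. destruct (H eps Heps) as [d Hd].
  exists d. split; [apply cond_pos|]. intros h Hh.
  destruct (Req_dec h 0) as [->|Hn].
  - rewrite Rplus_0_r. replace (f x - f x - l * 0) with 0 by ring.
    rewrite Rabs_R0. lra.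
  - specialize (Hd h Hn Hh).
    replace (f (x + h) - f x - l * h)
      with (((f (x + h) - f x) / h - l) * h) by (field; exact Hn).
    rewrite Rabs_mult. apply Rmult_le_compat_r; [apply Rabs_pos|lra].
Qed.

Lemma Rabs_Im_le (z : C) : Rabs (Im z) <= Cmod z.
Proof. eapply Rle_trans; [apply Rmax_r|apply Rmax_Cmod]. Qed.

(** With [w = x + i y], the error [cexp w - 1 - w] has real part
    [(exp x - 1 - x) + exp x * (cos y - 1)] and imaginary part
    [(sin y - y) + (exp x - 1) * sin y]; each term is controlled by the
    derivative of a real function at [0]. *)
Lemma Cis_derive_cexp_0 : Cis_derive cexp (RtoC 0) (RtoC 1).
Proof.
  apply Cis_derive_estimate. intros eps Heps.
  set (eta := Rmin 1 (eps / 9)).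
  assert (Heta : 0 < eta) by (apply Rmin_pos; lra).
  assert (Heta1 : eta <= 1) by apply Rmin_l.
  assert (Heta9 : 9 * eta <= eps)
    by (pose proof (Rmin_r 1 (eps / 9)); fold eta in H; lra).
  destruct (derivable_pt_lim_estimate exp 0 _ (derivable_pt_lim_exp 0) eta Heta)
    as [d1 [Hd1 He]].
  destruct (derivable_pt_lim_estimate sin 0 _ (derivable_pt_lim_sin 0) eta Heta)
    as [d2 [Hd2 Hs]].
  destruct (derivable_pt_lim_estimate cos 0 _ (derivable_pt_lim_cos 0) eta Heta)
    as [d3 [Hd3 Hc]].
  exists (Rmin eta (Rmin d1 (Rmin d2 d3))).
  split; [repeat apply Rmin_pos; lra|].
  intros w. replace (w - 0)%C with w by ring. intros Hw.
  pose proof (Rmin_l eta (Rmin d1 (Rmin d2 d3))).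
  pose proof (Rmin_r eta (Rmin d1 (Rmin d2 d3))).
  pose proof (Rmin_l d1 (Rmin d2 d3)). pose proof (Rmin_r d1 (Rmin d2 d3)).
  pose proof (Rmin_l d2 d3). pose proof (Rmin_r d2 d3).
  set (x := Re w). set (y := Im w).
  assert (Hx : Rabs x <= Cmod w) by apply re_le_Cmod.
  assert (Hy : Rabs y <= Cmod w) by apply Rabs_Im_le.
  assert (He' := He x ltac:(lra)). assert (Hs' := Hs y ltac:(lra)).
  assert (Hc' := Hc y ltac:(lra)).
  rewrite Rplus_0_l in He', Hs', Hc'.
  rewrite ?exp_0, ?sin_0, ?cos_0 in *.
  replace (exp x - 1 - 1 * x) with (exp x - 1 - x) in He' by ring.
  replace (sin y - 0 - 1 * y) with (sin y - y) in Hs' by ring.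
  replace (cos y - 1 - - 0 * y) with (cos y - 1) in Hc' by ring.
  assert (E1 : Rabs (exp x - 1) <= 2 * Rabs x).
  { replace (exp x - 1) with ((exp x - 1 - x) + x) by ring.
    eapply Rle_trans; [apply Rabs_triang|].
    pose proof (Rabs_pos x). nra. }
  assert (E2 : Rabs (exp x) <= 3).
  { replace (exp x) with ((exp x - 1) + 1) by ring.
    eapply Rle_trans; [apply Rabs_triang|]. rewrite Rabs_R1. lra. }
  assert (E3 : Rabs (sin y) <= 2 * Rabs y).
  { replace (sin y) with ((sin y - y) + y) by ring.
    eapply Rle_trans; [apply Rabs_triang|].
    pose proof (Rabs_pos y). nra. }
  eapply Rle_trans; [apply Cmod_le_Rabs|].
  assert (B1 : Rabs (Re (cexp w - cexp 0 - 1 * w))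
               <= eta * Rabs x + 3 * (eta * Rabs y)).
  { replace (Re (cexp w - cexp 0 - 1 * w))
      with ((exp x - 1 - x) + exp x * (cos y - 1)).
    - eapply Rle_trans; [apply Rabs_triang|]. rewrite Rabs_mult.
      apply Rplus_le_compat; [exact He'|].
      apply Rmult_le_compat; auto using Rabs_pos.
    - unfold x, y. simpl. rewrite ?exp_0, ?cos_0, ?sin_0. unfold Re, Im. ring. }
  assert (B2 : Rabs (Im (cexp w - cexp 0 - 1 * w))
               <= eta * Rabs y + 2 * eta * (2 * Rabs y)).
  { replace (Im (cexp w - cexp 0 - 1 * w))
      with ((sin y - y) + (exp x - 1) * sin y).
    - eapply Rle_trans; [apply Rabs_triang|]. rewrite Rabs_mult.
      apply Rplus_le_compat; [exact Hs'|].
      apply Rmult_le_compat; auto using Rabs_pos. lra.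
    - unfold x, y. simpl. rewrite ?exp_0, ?cos_0, ?sin_0. unfold Re, Im. ring. }
  assert (eta * Rabs x <= eta * Cmod w) by (apply Rmult_le_compat_l; lra).
  assert (eta * Rabs y <= eta * Cmod w) by (apply Rmult_le_compat_l; lra).
  pose proof (Cmod_ge_0 w).
  assert (9 * eta * Cmod w <= eps * Cmod w)
    by (apply Rmult_le_compat_r; assumption).
  lra.
Qed.

Lemma Cis_derive_ext (f g : C -> C) (z l : C) :
  (forall w, f w = g w) -> Cis_derive f z l -> Cis_derive g z l.
Proof. intros E. apply is_derive_ext. exact E. Qed.

Lemma Cis_derive_shift (f : C -> C) (a z l : C) :
  Cis_derive f (z + a)%C l -> Cis_derive (fun w => f (w + a))%C z l.
Proof.
  intros Hf. replace l with (l * (1 + 0))%C by ring.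
  apply (Cis_derive_comp (fun w => w + a)%C f z); [|exact Hf].
  apply Cis_derive_plus; [apply Cis_derive_id|apply Cis_derive_const].
Qed.

Lemma Cis_derive_cexp (z : C) : Cis_derive cexp z (cexp z).
Proof.
  apply Cis_derive_ext with (fun w => cexp z * cexp (w + - z))%C.
  { intros w. rewrite <- cexp_plus. f_equal. ring. }
  apply Cis_derive_eq with (0 * cexp (z + - z) + cexp z * 1)%C; [|ring].
  apply (Cis_derive_mult (fun _ => cexp z) (fun w => cexp (w + - z)%C));
    [apply Cis_derive_const|].
  apply Cis_derive_shift. replace (z + - z)%C with (RtoC 0) by ring.
  apply Cis_derive_cexp_0.
Qed.

(** In the coordinate [log z] the punctured disk becomes a half-plane, and
    Cauchy's theorem on a period rectangle shows that all circular means of [h]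
    agree.  The limit of these means at the centre is [h 0], for which continuity
    suffices; this is what makes the principle usable for difference quotients. *)
Lemma max_modulus (h : C -> C) (r M : R) :
  0 < r ->
  (forall z, 0 < Cmod z <= r -> exists l, Cis_derive h z l) ->
  Ccontinuous h (RtoC 0) ->
  (forall t : R, 0 <= t <= 2 * PI -> Cmod (h (polar r t)) <= M) ->
  Cmod (h (RtoC 0)) <= M.
Proof.
  intros Hr Hd H0 HM.
  apply le_epsilon. intros eps Heps.
  destruct (proj1 (Ccontinuous_iff h (RtoC 0)) H0 eps Heps) as [d [Hdp Hc]].
  (* The left side of the rectangle corresponds to a circle so small that [h]
     is within [eps] of [h 0] on it. *)
  set (s1 := ln (Rmin (d / 2) r)). set (s2 := ln r).
  assert (Hm : 0 < Rmin (d / 2) r) by (apply Rmin_pos; lra).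
  assert (E1 : exp s1 = Rmin (d / 2) r) by (apply exp_ln, Hm).
  assert (E2 : exp s2 = r) by (apply exp_ln, Hr).
  assert (Hs : s1 <= s2).
  { apply Rnot_lt_le. intros L. apply exp_increasing in L.
    pose proof (Rmin_r (d / 2) r). lra. }
  set (H := fun z => h (cexp z)).
  pose proof PI_RGT_0 as HPI.
  assert (HH : forall z, in_rect s1 s2 0 (2 * PI) z ->
    exists l, Cis_derive H z l).
  { intros z [[_ Hz] _].
    destruct (Hd (cexp z)) as [l Hl].
    - rewrite Cmod_cexp. split; [apply exp_pos|]. rewrite <- E2.
      destruct Hz as [Hz| ->]; [left; apply exp_increasing, Hz|right; reflexivity].
    - exists (l * cexp z)%C. apply (Cis_derive_comp cexp h); [|exact Hl].
      apply Cis_derive_cexp. }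
  assert (HC : forall z, in_rect s1 s2 0 (2 * PI) z -> Ccontinuous H z).
  { intros z Hz. destruct (HH z Hz) as [l Hl].
    exact (Cis_derive_continuous H z l Hl). }
  assert (Hpi : 0 <= 2 * PI) by lra.
  pose proof (Cauchy_Goursat_rect H s1 s2 0 (2 * PI) Hs Hpi HH) as G.
  unfold rect_int in G.
  rewrite (RInt_ext (V := C_R_CompleteNormedModule) _ (fun _ => RtoC 0)) in G.
  2:{ intros x _.
      replace (H (x, 2 * PI)) with (H (x, 0)).
      - change (H (x, 0)%R - H (x, 0)%R = 0)%C. ring.
      - unfold H, cexp, polar, Re, Im. simpl. rewrite cos_0, sin_0, cos_2PI, sin_2PI.
        reflexivity. }
  assert (X1 : ex_CInt (fun y => H (s1, y)) 0 (2 * PI))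
    by (apply (ex_CInt_ver H s1 s2); auto; lra).
  assert (X2 : ex_CInt (fun y => H (s2, y)) 0 (2 * PI))
    by (apply (ex_CInt_ver H s1 s2); auto; lra).
  rewrite (RInt_const (V := C_R_CompleteNormedModule)) in G.
  rewrite (RInt_minus (V := C_R_CompleteNormedModule)) in G by assumption.
  assert (B1 := CInt_near_const _ 0 (2 * PI) (h (RtoC 0)) eps Hpi X1).
  assert (B2 := CInt_near_const _ 0 (2 * PI) (RtoC 0) M Hpi X2).
  set (I1 := CInt (fun y => H (s1, y)) 0 (2 * PI)) in *.
  set (I2 := CInt (fun y => H (s2, y)) 0 (2 * PI)) in *.
  assert (EI : @eq C I1 I2).
  { change (scal (V := C_R_ModuleSpace) (s2 - s1)%R (RtoC 0) + Ci * (I2 - I1) = 0)%C in G.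
    rewrite (scal_R_Cmult (s2 - s1)%R (RtoC 0)) in G.
    replace (I1 : C) with ((I2 : C) + Ci * ((s2 - s1)%R * 0 + Ci * (I2 - I1)))%C.
    - rewrite G. ring.
    - replace (Ci * ((s2 - s1)%R * 0 + Ci * (I2 - I1)))%C
        with ((Ci * Ci) * (I2 - I1))%C by ring.
      replace (Ci * Ci)%C with (- (1))%C
        by (unfold Ci, Cmult, Copp, RtoC; simpl; f_equal; ring).
      ring. }
  assert (C1 : Cmod (I1 - (2 * PI - 0)%R * h 0) <= (2 * PI - 0) * eps).
  { apply B1. intros y _. left. apply Hc.
    replace (cexp (s1, y) - 0)%C with (cexp (s1, y)) by ring.
    rewrite Cmod_cexp. simpl. rewrite E1.
    pose proof (Rmin_l (d / 2) r). lra. }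
  assert (C2 : Cmod (I2 - (2 * PI - 0)%R * 0) <= (2 * PI - 0) * M).
  { apply B2. intros y Hy.
    replace (H (s2, y) - 0)%C with (H (s2, y)) by ring.
    unfold H, cexp. simpl. rewrite E2. apply HM, Hy. }
  rewrite EI in C1.
  assert (C3 : Cmod ((2 * PI - 0)%R * h 0) <= (2 * PI - 0) * (M + eps)).
  { replace ((2 * PI - 0)%R * h 0)%C
      with ((I2 - (2 * PI - 0)%R * 0) + - (I2 - (2 * PI - 0)%R * h 0))%C by ring.
    eapply Rle_trans; [apply Cmod_triangle|]. rewrite Cmod_opp. lra. }
  rewrite Cmod_mult, Cmod_R, Rabs_pos_eq in C3 by lra.
  apply Rmult_le_reg_l with (2 * PI - 0); lra.
Qed.

Lemma Cis_derive_minus_const (f : C -> C) (z l c : C) :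
  Cis_derive f z l -> Cis_derive (fun w => f w - c)%C z l.
Proof.
  intros Hf. replace l with (l + 0)%C by ring.
  apply (Cis_derive_plus f (fun _ => - c)%C); [exact Hf|apply Cis_derive_const].
Qed.

Lemma Cis_derive_diff_quot (f : C -> C) (z0 l0 z : C) :
  z <> z0 -> (exists l, Cis_derive f z l) ->
  exists l, Cis_derive (diff_quot f z0 l0) z l.
Proof.
  intros Hz [l Hl]. eexists.
  apply (is_derive_ext_loc (V := C_NormedModule)
    (fun w => (f w - f z0) * / (w - z0))%C).
  - apply locally_C. generalize (Clocally_neq _ z z0 (Ccontinuous_id z) Hz).
    apply filter_imp. intros w Hw. unfold diff_quot.
    destruct (Ceq_dec w z0); [contradiction|reflexivity].
  - apply Cis_derive_mult; [apply Cis_derive_minus_const, Hl|].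
    apply (Cis_derive_inv (fun w => w - z0)%C).
    + apply Cis_derive_minus_const, Cis_derive_id.
    + apply Cminus_eq_contra, Hz.
Qed.

(** The maximum modulus principle for the difference quotient of [f] at the
    origin, whose value there is the derivative. *)
Lemma Cauchy_estimate (f : C -> C) (l : C) (r K : R) :
  0 < r ->
  (forall z, Cmod z <= r -> exists l', Cis_derive f z l') ->
  Cis_derive f (RtoC 0) l ->
  (forall z, Cmod z = r -> Cmod (f z - f (RtoC 0)) <= K) ->
  Cmod l <= K / r.
Proof.
  intros Hr Hd H0 HK.
  rewrite <- (diff_quot_at f (RtoC 0) l).
  apply max_modulus with (r := r); [exact Hr| | |].
  - intros z [Hz1 Hz2]. apply Cis_derive_diff_quot.
    + apply Cmod_gt_0, Hz1.
    + apply Hd, Hz2.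
  - apply diff_quot_continuous, H0.
  - intros t _. set (z := polar r t).
    assert (Hz : Cmod z = r) by (apply Cmod_polar; lra).
    assert (Hz0 : z <> 0) by (apply Cmod_gt_0; lra).
    unfold diff_quot. destruct (Ceq_dec z 0) as [E|_]; [contradiction|].
    replace (z - 0)%C with z by ring.
    rewrite Cmod_div by exact Hz0. rewrite Hz.
    apply Rmult_le_compat_r; [left; apply Rinv_0_lt_compat, Hr|].
    apply HK, Hz.
Qed.

(** * Open mapping and the upper bound for the distance *)

Lemma continuous_polar (r t : R) :
  0 < r -> @continuous R_UniformSpace C_UniformSpace (polar r) t.
Proof.
  intros Hr.
  apply continuous_ext with (fun y => cexp (ln r, y)).
  - intros y. unfold cexp. simpl. rewrite exp_ln by exact Hr. reflexivity.
  - apply (continuous_comp (fun y => (ln r, y)) cexp).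
    + apply continuous_ver.
    + apply Cis_derive_continuous with (cexp (ln r, t)), Cis_derive_cexp.
Qed.

Lemma continuous_Cmod (z : C) : @continuous C_UniformSpace R_UniformSpace Cmod z.
Proof.
  intros P [e He]. apply (Clocally_iff z (fun w => P (Cmod w))).
  exists e. split; [apply cond_pos|]. intros w Hw. apply He.
  change (Rabs (Cmod w - Cmod z) < e).
  pose proof (Cmod_minus_le w z). pose proof (Cmod_minus_le z w) as H'.
  rewrite Cmod_minus_sym in H'. apply Rabs_def1; lra.
Qed.

Lemma circle_min (g : C -> C) (r : R) :
  0 < r -> (forall z, Cmod z = r -> Ccontinuous g z) ->
  (forall z, Cmod z = r -> g z <> 0) ->
  exists m, 0 < m /\ forall t, 0 <= t <= 2 * PI -> m <= Cmod (g (polar r t)).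
Proof.
  intros Hr Hc Hn. pose proof PI_RGT_0.
  assert (Hp : forall t, Cmod (polar r t) = r)
    by (intros t; apply Cmod_polar; lra).
  destruct (continuity_ab_min (fun t => Cmod (g (polar r t))) 0 (2 * PI))
    as [t0 [Hmin _]].
  - lra.
  - intros t _. apply continuity_pt_filterlim.
    apply (continuous_comp (fun t => g (polar r t)) Cmod).
    + apply (continuous_comp (polar r) g).
      * apply continuous_polar, Hr.
      * apply Hc, Hp.
    + apply continuous_Cmod.
  - exists (Cmod (g (polar r t0))). split; [apply Cmod_gt_0, Hn, Hp|].
    exact Hmin.
Qed.

(** Let [m] be the minimum of [|f - f zeta|] over the circle.  If a value [w] at
    distance less than [m / 2] from [f zeta] were omitted, then [1 / (f - w)]
    would be larger at the centre than on the circle. *)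
Lemma open_mapping (f : C -> C) (zeta : C) (r : R) :
  0 < r ->
  (forall z, Cmod (z - zeta) <= r -> exists l, Cis_derive f z l) ->
  (forall z, Cmod (z - zeta) <= r -> f z = f zeta -> z = zeta) ->
  exists m, 0 < m /\ forall w, Cmod (w - f zeta) < m ->
    exists z, Cmod (z - zeta) <= r /\ f z = w.
Proof.
  intros Hr Hd Hinj.
  assert (Ez : forall u, (u + zeta - zeta)%C = u) by (intros u; ring).
  assert (Hd' : forall u, Cmod u <= r ->
    exists l, Cis_derive (fun u => f (u + zeta))%C u l).
  { intros u Hu. destruct (Hd (u + zeta)%C) as [l Hl].
    - rewrite Ez. exact Hu.
    - exists l. apply Cis_derive_shift, Hl. }
  destruct (circle_min (fun u => f (u + zeta) - f zeta)%C r) as [m [Hm Hmin]].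
  - exact Hr.
  - intros u Hu. destruct (Hd' u) as [l Hl]; [lra|].
    eapply Cis_derive_continuous, Cis_derive_minus_const, Hl.
  - intros u Hu E. apply Ceq_minus in E. apply Hinj in E; [|rewrite Ez; lra].
    assert (E' : u = RtoC 0)
      by (replace u with (u + zeta - zeta)%C by ring; rewrite E; ring).
    rewrite E', Cmod_0 in Hu. lra.
  - exists (m / 2). split; [lra|]. intros w Hw.
    apply NNPP. intros Hno.
    assert (Hn : forall u, Cmod u <= r -> (f (u + zeta) - w)%C <> 0).
    { intros u Hu E. apply Ceq_minus in E. apply Hno.
      exists (u + zeta)%C. rewrite Ez. split; assumption. }
    assert (HM := max_modulus (fun u => / (f (u + zeta) - w))%C r (/ (m / 2)) Hr).
    cbv beta in HM.
    assert (Hdi : forall u, Cmod u <= r ->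
      exists l, Cis_derive (fun u => / (f (u + zeta) - w))%C u l).
    { intros u Hu. destruct (Hd' u Hu) as [l Hl]. eexists.
      apply (Cis_derive_inv (fun u => f (u + zeta) - w)%C).
      - apply Cis_derive_minus_const, Hl.
      - apply Hn, Hu. }
    assert (H0 : Cmod 0 <= r) by (rewrite Cmod_0; lra).
    specialize (Hn (RtoC 0) H0) as Hn0.
    rewrite Cmod_inv in HM by exact Hn0.
    replace (0 + zeta)%C with zeta in * by ring.
    assert (HB : / Cmod (f zeta - w) <= / (m / 2)).
    { apply HM.
      - intros z [_ Hz]. apply Hdi, Hz.
      - destruct (Hdi (RtoC 0) H0) as [l Hl].
        exact (Cis_derive_continuous _ _ _ Hl).
      - intros t Ht. specialize (Hmin t Ht). cbv beta in Hmin.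
        assert (Hp : Cmod (polar r t) <= r) by (rewrite Cmod_polar; lra).
        rewrite Cmod_inv by (apply Hn, Hp).
        apply Rinv_le_contravar; [lra|].
        pose proof (Cmod_triangle (f (polar r t + zeta)%C - w) (w - f zeta)) as T.
        replace (f (polar r t + zeta) - w + (w - f zeta))%C
          with (f (polar r t + zeta) - f zeta)%C in T by ring.
        lra. }
    rewrite Cmod_minus_sym in Hw. apply Cmod_gt_0 in Hn0.
    apply Rinv_lt_contravar in Hw; [lra|].
    apply Rmult_lt_0_compat; lra.
Qed.

(** Compactness of the closed disk as a Lebesgue number, with the choice of a
    radius at each point built in.  Boundedness, uniform continuity and the
    accumulation of values at a boundary point are all deduced from it. *)
Lemma disc_lebesgue (R0 : R) (Q : C -> R -> Prop) :
  (forall w, Cmod w <= R0 -> exists rho, 0 < rho /\ Q w rho) ->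
  exists d, 0 < d /\ forall z, Cmod z <= R0 ->
    exists w rho, Cmod w <= R0 /\ Q w rho /\ Cmod (z - w) < rho /\ d <= rho.
Proof.
  intros HQ.
  destruct (functional_choice (fun (w : C) (delta : posreal) =>
    (Cmod w <= R0 -> exists rho, Q w rho /\ 2 * delta <= rho) /\
    (R0 < Cmod w -> 2 * delta <= Cmod w - R0))) as [delta Hdelta].
  { intros w. destruct (Rle_lt_dec (Cmod w) R0) as [Hw|Hw].
    - destruct (HQ w Hw) as [rho [Hr H]].
      exists (mkposreal (rho / 2) ltac:(lra)). simpl. split; [|lra].
      intros _. exists rho. split; [exact H|lra].
    - exists (mkposreal ((Cmod w - R0) / 2) ltac:(lra)). simpl.
      split; [lra|]. intros _. lra. }
  destruct (compactness_value_2d (- R0) R0 (- R0) R0 (fun u v => delta (u, v)))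
    as [d Hd].
  exists d. split; [apply cond_pos|]. intros z Hz.
  pose proof (re_le_Cmod z) as Hx. pose proof (Rabs_Im_le z) as Hy.
  specialize (Hd (Re z) (Im z)).
  apply NNPP. intros Hno.
  apply Hd; [apply Rabs_le_between; lra|apply Rabs_le_between; lra|].
  intros [u [v [_ [_ [H1 [H2 H3]]]]]]. apply Hno.
  destruct (Hdelta (u, v)) as [D1 D2].
  assert (Hdist : Cmod (z - (u, v)) < 2 * delta (u, v)).
  { eapply Rle_lt_trans; [apply Cmod_le_Rabs|].
    change (Rabs (Re z - u) + Rabs (Im z - v) < 2 * delta (u, v)). lra. }
  destruct (Rle_lt_dec (Cmod (u, v)) R0) as [Hw|Hw].
  - destruct (D1 Hw) as [rho [Hrho H]].
    exists (u, v), rho. split; [exact Hw|]. split; [exact Hrho|].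
    pose proof (cond_pos (delta (u, v))). split; lra.
  - specialize (D2 Hw). pose proof (Cmod_minus_le (u, v) z) as T.
    rewrite Cmod_minus_sym in T. lra.
Qed.

(** The function [z / f z], completed by [1] at the origin, cannot be smaller
    than [1] on a whole circle. *)
Lemma class_S_small_values (f : C -> C) (rho : R) :
  class_S f -> 0 < rho ->
  exists z, 1 - rho <= Cmod z < 1 /\ Cmod (f z) <= 1 + rho.
Proof.
  intros [Hd [Hinj [H0 H1]]] Hrho.
  apply NNPP. intros Hno.
  (* The value [1 / 2] only keeps the radius positive when [rho] is large. *)
  set (r := Rmax (1 - rho) (1 / 2)).
  assert (Hr1 : r < 1) by (apply Rmax_lub_lt; lra).
  assert (Hr2 : 1 - rho <= r) by apply Rmax_l.
  assert (Hr3 : 1 / 2 <= r) by apply Rmax_r.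
  set (q := diff_quot f 0 1).
  assert (Hq : forall z, Cmod z < 1 -> q z <> 0).
  { intros z Hz E. unfold q, diff_quot in E.
    destruct (Ceq_dec z 0) as [_|Hn]; [exact (C1_nz E)|].
    assert (Hfz : f z <> 0).
    { intros E0. apply Hn. apply Hinj.
      - exact Hz.
      - unfold unit_disk. rewrite Cmod_0. lra.
      - rewrite E0, H0. reflexivity. }
    rewrite H0 in E. revert E.
    replace ((f z - 0) / (z - 0))%C with (f z * / z)%C
      by (field; exact Hn).
    apply Cmult_neq_0; [exact Hfz|].
    apply Cmod_gt_0. rewrite Cmod_inv by exact Hn.
    apply Rinv_0_lt_compat, Cmod_gt_0, Hn. }
  assert (Hq0 : q 0 = 1) by apply diff_quot_at.
  assert (HM : Cmod (/ q 0) <= / (1 + rho)).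
  { apply (max_modulus (fun z => / q z)%C r).
    - lra.
    - intros z [Hz1 Hz2].
      destruct (Cis_derive_diff_quot f 0 1 z) as [l Hl].
      + apply Cmod_gt_0, Hz1.
      + apply Hd. unfold unit_disk. lra.
      + eexists. apply (Cis_derive_inv q z l Hl). apply Hq. lra.
    - apply Ccontinuous_inv; [apply diff_quot_continuous, H1|].
      apply Hq. rewrite Cmod_0. lra.
    - intros t _. set (z := polar r t).
      assert (Hz : Cmod z = r) by (apply Cmod_polar; lra).
      assert (Hn : z <> 0) by (apply Cmod_gt_0; lra).
      rewrite Cmod_inv by (apply Hq; lra).
      apply Rinv_le_contravar; [lra|].
      unfold q, diff_quot. destruct (Ceq_dec z 0) as [E|_]; [contradiction|].
      rewrite H0.
      replace ((f z - 0) / (z - 0))%C with (f z / z)%C by (field; exact Hn).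
      rewrite Cmod_div, Hz by exact Hn.
      assert (Hf : 1 + rho < Cmod (f z)).
      { apply Rnot_le_lt. intros L. apply Hno. exists z. lra. }
      apply Rle_div_r; [lra|].
      assert ((1 + rho) * r <= (1 + rho) * 1)
        by (apply Rmult_le_compat_l; lra).
      lra. }
  rewrite Hq0 in HM. replace (/ 1)%C with (RtoC 1) in HM by (field; exact C1_nz).
  rewrite Cmod_1 in HM.
  assert (/ (1 + rho) < / 1) by (apply Rinv_lt_contravar; lra).
  rewrite Rinv_1 in *. lra.
Qed.

Lemma not_boundary (A : C -> Prop) (w : C) : ~ boundary A w ->
  exists e, 0 < e /\ ((forall u, Cmod (u - w) < e -> ~ A u) \/
                      (forall u, Cmod (u - w) < e -> A u)).
Proof.
  intros H. apply NNPP. intros Hno. apply H.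
  intros N HN. apply Clocally_iff in HN. destruct HN as [e [He HN]].
  split; apply NNPP; intros Hn; apply Hno; exists e; (split; [exact He|]).
  - left. intros u Hu HA. apply Hn. exists u. auto.
  - right. intros u Hu. apply NNPP. intros HA. apply Hn. exists u. auto.
Qed.

(** A point that is not on the boundary has a neighbourhood that the values of
    [f] close to the unit circle avoid.  Compactness of the disk of radius [2]
    makes this uniform, against [class_S_small_values]. *)
Lemma class_S_boundary_point (f : C -> C) :
  class_S f -> exists w, boundary (image f unit_disk) w /\ Cmod w <= 1.
Proof.
  intros Hf. apply NNPP. intros Hno.
  destruct (disc_lebesgue 2 (fun w rho => forall z,
    1 - rho <= Cmod z < 1 -> Cmod (f z) <= 1 + rho -> rho <= Cmod (f z - w)))
    as [d [Hd H]].
  - intros w _. destruct (Rle_lt_dec (Cmod w) 1) as [Hw|Hw].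
    + destruct (not_boundary (image f unit_disk) w) as [e [He [Ho|Hi]]].
      * intros B. apply Hno. exists w. auto.
      * exists e. split; [exact He|]. intros z Hz _.
        apply Rnot_lt_le. intros L. apply (Ho _ L).
        exists z. split; [apply Hz|reflexivity].
      * destruct (Hi w) as [zeta [Hzeta E]].
        { replace (w - w)%C with (RtoC 0) by ring. rewrite Cmod_0. exact He. }
        unfold unit_disk in Hzeta. set (r := (1 - Cmod zeta) / 2).
        assert (In : forall z, Cmod (z - zeta) <= r -> Cmod z <= 1 - r).
        { intros z Hz. pose proof (Cmod_minus_le z zeta). unfold r in *. lra. }
        destruct Hf as [Hdf [Hinj _]].
        destruct (open_mapping f zeta r) as [m [Hm Hop]].
        { unfold r; lra. }
        { intros z Hz. apply In in Hz. apply Hdf.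
          unfold unit_disk, r in *. lra. }
        { intros z Hz. apply In in Hz. apply Hinj; unfold unit_disk, r in *; lra. }
        exists (Rmin m (r / 2)). split; [apply Rmin_pos; unfold r in *; lra|].
        intros z Hz _. apply Rnot_lt_le. intros L.
        pose proof (Rmin_l m (r / 2)). pose proof (Rmin_r m (r / 2)).
        destruct (Hop (f z)) as [z' [Hz' E']]; [rewrite E; lra|].
        apply In in Hz'.
        assert (z' = z)
          by (apply Hinj; [unfold unit_disk, r in *; lra|apply Hz|exact E']).
        subst z'. unfold r in *. lra.
    + exists ((Cmod w - 1) / 2). split; [lra|]. intros z _ Hz.
      pose proof (Cmod_minus_le w (f z)) as T. rewrite Cmod_minus_sym in T. lra.
  - destruct (class_S_small_values f (Rmin d 1) Hf) as [z [Hz1 Hz2]];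
      [apply Rmin_pos; lra|].
    pose proof (Rmin_l d 1). pose proof (Rmin_r d 1).
    destruct (H (f z)) as [w [rho [_ [HQ [Hlt Hle]]]]]; [lra|].
    assert (rho <= Cmod (f z - w)) by (apply HQ; lra). lra.
Qed.

(** * Square roots of nonvanishing functions on the disk *)

Lemma disc_bounded (h : C -> C) :
  (forall z, Cmod z <= 1 -> Ccontinuous h z) ->
  exists B, 0 < B /\ forall z, Cmod z <= 1 -> Cmod (h z) <= B.
Proof.
  intros Hc.
  destruct (disc_lebesgue 1 (fun w rho =>
    forall z, Cmod (z - w) < rho -> Cmod (h z) <= / rho)) as [d [Hd H]].
  - intros w Hw.
    destruct (proj1 (Ccontinuous_iff h w) (Hc w Hw) 1 Rlt_0_1) as [e [He E]].
    pose proof (Cmod_ge_0 (h w)).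
    assert (Hp : 0 < / (Cmod (h w) + 1)) by (apply Rinv_0_lt_compat; lra).
    assert (Hm : 0 < Rmin e (/ (Cmod (h w) + 1))) by (apply Rmin_pos; lra).
    exists (Rmin e (/ (Cmod (h w) + 1))). split; [exact Hm|].
    intros z Hz. pose proof (Rmin_l e (/ (Cmod (h w) + 1))).
    specialize (E z ltac:(lra)).
    apply Rle_trans with (/ / (Cmod (h w) + 1)).
    + rewrite Rinv_inv. pose proof (Cmod_minus_le (h z) (h w)). lra.
    + apply Rinv_le_contravar; [exact Hm|apply Rmin_r].
  - exists (/ d). split; [apply Rinv_0_lt_compat, Hd|].
    intros z Hz. destruct (H z Hz) as [w [rho [_ [HQ [Hlt Hle]]]]].
    eapply Rle_trans; [apply HQ, Hlt|]. apply Rinv_le_contravar; assumption.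
Qed.

Lemma disc_uniformly_continuous (h : C -> C) (eps : R) :
  0 < eps -> (forall z, Cmod z <= 1 -> Ccontinuous h z) ->
  exists d, 0 < d /\ forall z z', Cmod z <= 1 -> Cmod (z' - z) < d ->
    Cmod (h z' - h z) < eps.
Proof.
  intros Heps Hc.
  destruct (disc_lebesgue 1 (fun w rho =>
    forall z, Cmod (z - w) < 2 * rho -> Cmod (h z - h w) < eps / 2))
    as [d [Hd H]].
  - intros w Hw.
    destruct (proj1 (Ccontinuous_iff h w) (Hc w Hw) (eps / 2)) as [e [He E]];
      [lra|].
    exists (e / 2). split; [lra|]. intros z Hz. apply E. lra.
  - exists d. split; [exact Hd|]. intros z z' Hz Hzz.
    destruct (H z Hz) as [w [rho [_ [HQ [Hlt Hle]]]]].
    assert (Q1 := HQ z ltac:(lra)).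
    assert (Q2 : Cmod (h z' - h w) < eps / 2).
    { apply HQ. replace (z' - w)%C with ((z' - z) + (z - w))%C by ring.
      eapply Rle_lt_trans; [apply Cmod_triangle|]. lra. }
    replace (h z' - h z)%C with ((h z' - h w) + - (h z - h w))%C by ring.
    eapply Rle_lt_trans; [apply Cmod_triangle|]. rewrite Cmod_opp. lra.
Qed.

(** The principal branch on the right half-plane, in a form without arguments:
    [q + |q|] lies on the bisector of the angle between [q] and the positive
    axis, and [(q + |q|) ^ 2 = 2 * (|q| + Re q) * q]. *)
Definition principal_sqrt (q : C) : C :=
  ((q + Cmod q) * (/ sqrt (2 * (Cmod q + Re q)))%R)%C.

Lemma principal_sqrt_sqr (q : C) :
  0 < Re q -> (principal_sqrt q * principal_sqrt q)%C = q.
Proof.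
  intros Hq. pose proof (Cmod_ge_0 q).
  assert (Hp : 0 < 2 * (Cmod q + Re q)) by lra.
  unfold principal_sqrt. set (s := sqrt (2 * (Cmod q + Re q))).
  assert (Hs : (/ s * / s)%R = / (2 * (Cmod q + Re q)))
    by (rewrite <- Rinv_mult; unfold s; rewrite sqrt_sqrt by lra; reflexivity).
  replace ((q + Cmod q) * (/ s)%R * ((q + Cmod q) * (/ s)%R))%C
    with ((q + Cmod q) * (q + Cmod q) * ((/ s)%R * (/ s)%R))%C by ring.
  rewrite <- RtoC_mult, Hs.
  assert (E : ((q + Cmod q) * (q + Cmod q) = (2 * (Cmod q + Re q))%R * q)%C).
  { assert (E2 : Cmod q * Cmod q = Re q * Re q + Im q * Im q)
      by (pose proof (Cmod2_alt q); lra).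
    generalize dependent (Cmod q). intros c. intros.
    destruct q as [x y]. unfold Cmult, Cplus, RtoC, Re, Im in *. simpl in *.
    f_equal; [|ring]. ring_simplify. ring_simplify in E2. lra. }
  rewrite E. rewrite RtoC_inv by lra. field.
  intros H0. apply RtoC_inj in H0. lra.
Qed.

Lemma principal_sqrt_continuous (q : C) :
  0 < Re q -> Ccontinuous principal_sqrt q.
Proof.
  intros Hq. pose proof (Cmod_ge_0 q).
  assert (HR : forall phi : C -> R,
    @continuous C_UniformSpace R_UniformSpace phi q ->
    Ccontinuous (fun w => RtoC (phi w)) q).
  { intros phi Hphi. apply (continuous_comp phi RtoC); [exact Hphi|].
    apply (continuous_hor 0). }
  apply Ccontinuous_mult.
  - apply Ccontinuous_plus; [apply Ccontinuous_id|].
    apply HR, continuous_Cmod.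
  - apply HR.
    apply (continuous_comp (fun w => Cmod w + Re w)
                           (fun u => / sqrt (2 * u))).
    + apply (continuous_plus (V := R_NormedModule)).
      * apply continuous_Cmod.
      * apply (continuous_fst (U := R_UniformSpace) (V := R_UniformSpace)).
    + apply (ex_derive_continuous (K := R_AbsRing) (V := R_NormedModule)).
      auto_derive. split; [lra|]. split; [|exact I].
      apply Rgt_not_eq, sqrt_lt_R0. lra.
Qed.

Lemma Re_pos_near_1 (q : C) : Cmod (q - 1) < 1 -> 0 < Re q.
Proof.
  intros H. pose proof (re_le_Cmod (q - 1)) as H'.
  assert (E : Re (q - 1) = Re q - 1) by reflexivity.
  rewrite E in H'.
  assert (H2 : Rabs (Re q - 1) < 1) by lra.
  apply Rabs_def2 in H2. lra.
Qed.

Lemma Ccontinuous_scal_arg (h : C -> C) (c z : C) :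
  Ccontinuous h (c * z)%C -> Ccontinuous (fun w => h (c * w)%C) z.
Proof.
  intros H. apply (Ccontinuous_comp (fun w => c * w)%C h); [|exact H].
  apply Ccontinuous_mult; [apply Ccontinuous_const|apply Ccontinuous_id].
Qed.

(** By uniform continuity there is [n] such that [h] changes by a factor close
    to [1] between [k / n * z] and [(k + 1) / n * z].  So [h z] is a product of [n]
    ratios in the right half-plane, each of which has a principal square root. *)
Lemma continuous_sqrt_on_disc (h : C -> C) :
  (forall z, Cmod z <= 1 -> Ccontinuous h z) ->
  (forall z, Cmod z <= 1 -> h z <> 0) -> h 0 = 1 ->
  exists g : C -> C, g 0 = 1 /\ forall z, Cmod z <= 1 ->
    Ccontinuous g z /\ (g z * g z)%C = h z.
Proof.
  intros Hc Hn H0.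
  destruct (disc_bounded (fun z => / h z)%C) as [B [HB HB']].
  { intros z Hz. apply Ccontinuous_inv; auto. }
  destruct (disc_uniformly_continuous h (/ B)) as [d [Hd Hu]];
    [apply Rinv_0_lt_compat, HB|exact Hc|].
  destruct (nfloor_ex (/ d)) as [N [_ HN]];
    [left; apply Rinv_0_lt_compat, Hd|].
  rewrite <- S_INR in HN. set (n := INR (S N)) in *.
  assert (Hdinv : 0 < / d) by (apply Rinv_0_lt_compat, Hd).
  assert (Hn0 : 0 < n) by lra.
  assert (Hnd : / n < d).
  { rewrite <- (Rinv_inv d). apply Rinv_lt_contravar; [|exact HN].
    apply Rmult_lt_0_compat; lra. }
  assert (HT : forall k z, (k <= S N)%nat -> Cmod z <= 1 ->
    Cmod ((INR k / n)%R * z) <= 1).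
  { intros k z Hk Hz. apply le_INR in Hk. fold n in Hk.
    assert (Hk0 := pos_INR k).
    assert (HI : 0 <= INR k / n <= 1).
    { split; [apply Rdiv_le_0_compat; lra|].
      apply Rle_div_l; lra. }
    rewrite Cmod_mult, Cmod_R, Rabs_pos_eq by lra.
    pose proof (Cmod_ge_0 z).
    apply Rle_trans with (1 * 1); [apply Rmult_le_compat|]; lra. }
  assert (Ind : forall k, (k <= S N)%nat -> exists g : C -> C, forall z, Cmod z <= 1 ->
    Ccontinuous g z /\ (g z * g z = h ((INR k / n)%R * z))%C).
  { induction k as [|k IH]; intros Hk.
    - exists (fun _ => RtoC 1). intros z Hz. split; [apply Ccontinuous_const|].
      simpl INR. replace (0 / n) with 0 by (field; lra).
      rewrite Cmult_0_l, H0. ring.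
    - destruct IH as [g Hg]; [lia|].
      exists (fun z => g z * principal_sqrt (h ((INR (S k) / n)%R * z)
                                    / h ((INR k / n)%R * z)))%C.
      intros z Hz. destruct (Hg z Hz) as [Cg Eg].
      set (z1 := ((INR (S k) / n)%R * z)%C) in *.
      set (z0 := ((INR k / n)%R * z)%C) in *.
      assert (Hz1 : Cmod z1 <= 1) by (apply HT; assumption).
      assert (Hz0 : Cmod z0 <= 1) by (apply HT; [lia|assumption]).
      assert (Hclose : Cmod (z1 - z0) < d).
      { replace (z1 - z0)%C with ((/ n)%R * z)%C.
        - rewrite Cmod_mult, Cmod_R, Rabs_pos_eq
            by (left; apply Rinv_0_lt_compat, Hn0).
          apply Rle_lt_trans with (/ n * 1); [|lra].
          apply Rmult_le_compat_l; [left; apply Rinv_0_lt_compat, Hn0|exact Hz].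
        - unfold z1, z0. rewrite S_INR.
          replace ((INR k + 1) / n) with (INR k / n + / n) by (field; lra).
          rewrite RtoC_plus. ring. }
      assert (Hre : 0 < Re (h z1 / h z0)).
      { apply Re_pos_near_1.
        replace (h z1 / h z0 - 1)%C with ((h z1 - h z0) * / h z0)%C
          by (field; auto).
        rewrite Cmod_mult. specialize (HB' z0 Hz0). cbv beta in HB'.
        specialize (Hu z0 z1 Hz0 Hclose).
        pose proof (Cmod_ge_0 (/ h z0)). pose proof (Cmod_ge_0 (h z1 - h z0)).
        apply Rle_lt_trans with (Cmod (h z1 - h z0) * B).
        - apply Rmult_le_compat_l; assumption.
        - apply (Rmult_lt_compat_r B) in Hu; [|exact HB].
          rewrite Rinv_l in Hu by lra. exact Hu. }
      split.
      + apply Ccontinuous_mult; [exact Cg|].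
        apply (Ccontinuous_comp
          (fun z => h ((INR (S k) / n)%R * z) / h ((INR k / n)%R * z))%C principal_sqrt);
          [|apply principal_sqrt_continuous, Hre].
        apply Ccontinuous_mult; [|apply Ccontinuous_inv];
          try apply Ccontinuous_scal_arg; auto.
      + transitivity ((g z * g z) * (principal_sqrt (h z1 / h z0)
                                      * principal_sqrt (h z1 / h z0)))%C;
          [ring|].
        rewrite principal_sqrt_sqr by exact Hre. rewrite Eg. field. auto. }
  destruct (Ind (S N) (le_n _)) as [g Hg].
  assert (E1 : INR (S N) / n = 1) by (unfold n; field; apply not_0_INR; lia).
  assert (H00 : Cmod 0 <= 1) by (rewrite Cmod_0; lra).
  destruct (Hg _ H00) as [_ Eg0]. rewrite Cmult_0_r, H0 in Eg0.
  (* dividing by [g 0], whose square is 1, selects the branch *)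
  assert (Hg0 : g 0 <> 0).
  { intros E. rewrite E, Cmult_0_l in Eg0. symmetry in Eg0. exact (C1_nz Eg0). }
  exists (fun z => g z / g 0)%C. split; [field; exact Hg0|].
  intros z Hz. destruct (Hg z Hz) as [Cg Eg]. split.
  - apply Ccontinuous_mult; [exact Cg|apply Ccontinuous_const].
  - transitivity ((g z * g z) / (g 0 * g 0))%C; [field; exact Hg0|].
    rewrite Eg, Eg0, E1, Cmult_1_l. field.
Qed.

(** * The lower bound for the distance *)

Lemma Cis_derive_affine (f : C -> C) (a b z l : C) :
  Cis_derive f z l -> Cis_derive (fun w => a + b * f w)%C z (b * l)%C.
Proof.
  intros Hf. apply Cis_derive_eq with (0 + (0 * f z + b * l))%C; [|ring].
  apply (Cis_derive_plus (fun _ => a) (fun w => b * f w)%C);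
    [apply Cis_derive_const|].
  apply (Cis_derive_mult (fun _ => b) f); [apply Cis_derive_const|exact Hf].
Qed.

Lemma Cis_derive_scal_arg (f : C -> C) (c z l : C) :
  Cis_derive f (c * z)%C l -> Cis_derive (fun w => f (c * w)%C) z (l * c)%C.
Proof.
  intros Hf. apply (Cis_derive_comp (fun w => c * w)%C f); [|exact Hf].
  apply Cis_derive_eq with (0 * z + c * 1)%C; [|ring].
  apply (Cis_derive_mult (fun _ => c) (fun w => w));
    [apply Cis_derive_const|apply Cis_derive_id].
Qed.

Lemma unit_disk_0 : unit_disk 0.
Proof. unfold unit_disk. rewrite Cmod_0. lra. Qed.

Lemma RtoC_neq_0 (x : R) : x <> 0 -> RtoC x <> 0.
Proof. intros H E. apply H, RtoC_inj, E. Qed.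

Lemma Cmod_half (z : C) : Cmod ((/ 2)%R * z) = Cmod z / 2.
Proof. rewrite Cmod_mult, Cmod_R, Rabs_pos_eq by lra. field. Qed.

(** Schwarz's lemma would give [1]; the Cauchy estimate on the circle of radius
    [1 / 2] is enough here. *)
Lemma class_S_bound_ge_half (f : C -> C) (M : R) :
  class_S f -> (forall z, unit_disk z -> Cmod (f z) <= M) -> / 2 <= M.
Proof.
  intros [Hd [_ [H0 H1]]] HM.
  assert (H : Cmod 1 <= M / (1 / 2)).
  { apply (Cauchy_estimate f 1 (1 / 2) M); [lra| |exact H1|].
    - intros z Hz. apply Hd. unfold unit_disk. lra.
    - intros z Hz. rewrite H0. replace (f z - 0)%C with (f z) by ring.
      apply HM. unfold unit_disk. lra. }
  rewrite Cmod_1 in H. replace (M / (1 / 2)) with (2 * M) in H by field. lra.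
Qed.

(** Since [g] never takes opposite values, covering the disk of radius [rho]
    around [1] would keep it out of the disk of radius [rho] around [-1].  Then
    [1 / (1 + g)] is at most [1 / rho], and its derivative [- a / 4] at the origin
    is at most [2 * (1 / rho + 1 / 2)]. *)
Lemma large_derivative_omits_near_1 (g : C -> C) (a : C) (rho : R) :
  (forall z, unit_disk z -> exists l, Cis_derive g z l) ->
  g 0 = 1 -> Cis_derive g (RtoC 0) a ->
  (forall z z', unit_disk z -> unit_disk z' -> (g z + g z')%C <> 0) ->
  0 < rho -> 8 / rho + 4 < Cmod a ->
  exists u, Cmod (u - 1) < rho /\ ~ image g unit_disk u.
Proof.
  intros Hd H0 Ha Hodd Hrho Hlarge. apply NNPP. intros Hno.
  assert (Hfar : forall z, unit_disk z -> rho <= Cmod (g z + 1)).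
  { intros z Hz. apply Rnot_lt_le. intros L. apply Hno.
    exists (- g z)%C. split.
    - replace (- g z - 1)%C with (- (g z + 1))%C by ring.
      rewrite Cmod_opp. exact L.
    - intros [z' [Hz' E]]. apply (Hodd z z' Hz Hz'). rewrite E. ring. }
  assert (Hn : forall z, unit_disk z -> (1 + 1 * g z)%C <> 0).
  { intros z Hz. apply Cmod_gt_0. specialize (Hfar z Hz).
    replace (1 + 1 * g z)%C with (g z + 1)%C by ring. lra. }
  assert (Hinv : forall z, unit_disk z -> Cmod (/ (1 + 1 * g z)) <= / rho).
  { intros z Hz. rewrite Cmod_inv by (apply Hn, Hz).
    apply Rinv_le_contravar; [exact Hrho|].
    replace (1 + 1 * g z)%C with (g z + 1)%C by ring. apply Hfar, Hz. }
  assert (HC : Cmod (- (1 * a) / ((1 + 1 * g 0) * (1 + 1 * g 0)))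
               <= (/ rho + / 2) / (1 / 2)).
  { apply (Cauchy_estimate (fun z => / (1 + 1 * g z))%C); [lra| | |].
    - intros z Hz. assert (Hu : unit_disk z) by (unfold unit_disk; lra).
      destruct (Hd z Hu) as [l Hl]. eexists.
      apply (Cis_derive_inv (fun z => 1 + 1 * g z)%C).
      + apply Cis_derive_affine, Hl.
      + apply Hn, Hu.
    - apply (Cis_derive_inv (fun z => 1 + 1 * g z)%C).
      + apply Cis_derive_affine, Ha.
      + apply Hn, unit_disk_0.
    - intros z Hz. eapply Rle_trans; [apply Cmod_triangle|].
      rewrite Cmod_opp. apply Rplus_le_compat.
      + apply Hinv. unfold unit_disk. lra.
      + rewrite H0. replace (1 + 1 * 1)%C with (RtoC 2)
          by (unfold Cplus, Cmult, RtoC; simpl; f_equal; ring).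
        rewrite <- RtoC_inv by lra. rewrite Cmod_R, Rabs_pos_eq; lra. }
  rewrite H0 in HC.
  replace (- (1 * a) / ((1 + 1 * 1) * (1 + 1 * 1)))%C
    with (- a * (/ 4)%R)%C in HC.
  2:{ replace (/ 4) with (/ (2 * 2)) by field.
      replace (1 + 1 * 1)%C with (RtoC 2)
        by (unfold Cplus, Cmult, RtoC; simpl; f_equal; ring).
      rewrite RtoC_inv, RtoC_mult by lra. field. }
  rewrite Cmod_mult, Cmod_opp, Cmod_R, Rabs_pos_eq in HC by lra.
  replace ((/ rho + / 2) / (1 / 2)) with (/ 4 * (8 / rho + 4)) in HC
    by (field; lra).
  lra.
Qed.

(** The square root transform of the function [2 * f (z / 2)], which omits
    [2 * w].  Passing to the disk of radius [2] makes the function available on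
    the closed unit disk, where the square root is constructed. *)
Lemma koebe_transform (f : C -> C) (M : R) (w : C) :
  class_S f -> (forall z, unit_disk z -> Cmod (f z) <= M) ->
  ~ image f unit_disk w -> Cmod w <= / 256 ->
  exists (f1 : C -> C) (w1 : C), class_S f1 /\
    (forall z, unit_disk z -> Cmod (f1 z) <= M / 2) /\
    ~ image f1 unit_disk w1 /\ Cmod w1 <= / 256.
Proof.
  intros Hf HM Hw Hsmall.
  pose proof (class_S_bound_ge_half f M Hf HM) as HM2.
  destruct Hf as [Hd [Hinj [H0 H1]]].
  assert (Hw0 : w <> 0).
  { intros ->. apply Hw. exists (RtoC 0). split; [exact unit_disk_0|exact H0]. }
  assert (Hwpos := proj1 (Cmod_gt_0 w) Hw0).
  (* [g] is the square root of [h z = 1 - f (z / 2) / w]. *)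
  set (c := RtoC (/ 2)).
  assert (Hc : forall z, Cmod (c * z) = Cmod z / 2) by (intros; apply Cmod_half).
  assert (Hc0 : c <> 0) by (apply RtoC_neq_0; lra).
  assert (Hcin : forall z, Cmod z <= 1 -> unit_disk (c * z))
    by (intros z Hz; unfold unit_disk; rewrite Hc; lra).
  assert (Hcin' : forall z, unit_disk z -> unit_disk (c * z))
    by (intros z Hz; apply Hcin; unfold unit_disk in Hz; lra).
  set (h := fun z => (1 + - / w * f (c * z))%C).
  assert (Hh : forall z, h z = ((w - f (c * z)) / w)%C)
    by (intros z; unfold h; field; exact Hw0).
  assert (Hhn : forall z, Cmod z <= 1 -> h z <> 0).
  { intros z Hz E. rewrite Hh in E. apply Hw. exists (c * z)%C.
    split; [apply Hcin, Hz|].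
    assert (E' : (w - f (c * z) = 0)%C).
    { replace (w - f (c * z))%C with ((w - f (c * z)) / w * w)%C
        by (field; exact Hw0). rewrite E. ring. }
    symmetry. apply Ceq_minus, E'. }
  assert (Hhd : forall z l, Cis_derive f (c * z)%C l ->
    Cis_derive h z (- / w * (l * c))%C).
  { intros z l Hl.
    apply (Cis_derive_affine (fun z => f (c * z)%C)), Cis_derive_scal_arg, Hl. }
  assert (Hh0 : h 0 = 1) by (unfold h; rewrite Cmult_0_r, H0; ring).
  destruct (continuous_sqrt_on_disc h) as [g [Hg0 Hg]];
    [|exact Hhn|exact Hh0|].
  { intros z Hz. destruct (Hd _ (Hcin z Hz)) as [l Hl].
    exact (Cis_derive_continuous h z _ (Hhd z l Hl)). }
  assert (Hgn : forall z, Cmod z <= 1 -> g z <> 0).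
  { intros z Hz E. apply (Hhn z Hz). rewrite <- (proj2 (Hg z Hz)), E. ring. }
  assert (Hgd : forall z l, unit_disk z -> Cis_derive h z l ->
    Cis_derive g z (l / (2 * g z))%C).
  { intros z l Hz Hl. unfold unit_disk in Hz.
    apply (Cis_derive_sqrt g h); [apply Hg; lra|apply Hgn; lra| |exact Hl].
    apply Clocally_iff. exists (1 - Cmod z). split; [lra|].
    intros u Hu. apply Hg. pose proof (Cmod_minus_le u z). lra. }
  assert (Hgd' : forall z, unit_disk z -> exists l, Cis_derive g z l).
  { intros z Hz. destruct (Hd _ (Hcin' z Hz)) as [l Hl].
    eexists. apply Hgd; [exact Hz|]. apply Hhd, Hl. }
  assert (Hhinj : forall z z', unit_disk z -> unit_disk z' -> h z = h z' -> z = z').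
  { intros z z' Hz Hz' E.
    assert (Ef : f (c * z)%C = f (c * z')%C).
    { rewrite !Hh in E.
      replace (f (c * z))%C with (w - (w - f (c * z)) / w * w)%C
        by (field; exact Hw0).
      rewrite E. field. exact Hw0. }
    apply Hinj in Ef; auto.
    replace z with (/ c * (c * z))%C by (field; exact Hc0).
    rewrite Ef. field. exact Hc0. }
  assert (Hginj : forall z z', unit_disk z -> unit_disk z' ->
    (g z * g z = g z' * g z')%C -> z = z').
  { intros z z' Hz Hz' E. apply Hhinj; auto.
    rewrite <- (proj2 (Hg z ltac:(unfold unit_disk in Hz; lra))).
    rewrite <- (proj2 (Hg z' ltac:(unfold unit_disk in Hz'; lra))). exact E. }
  assert (H2 : RtoC 2 <> 0) by (apply RtoC_neq_0; lra).
  assert (Ec : c = (/ 2)%C) by (unfold c; apply RtoC_inv; lra).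
  assert (Hga : Cis_derive g (RtoC 0) (- / (4 * w))%C).
  { eapply Cis_derive_eq.
    - apply Hgd; [exact unit_disk_0|]. apply Hhd. rewrite Cmult_0_r. exact H1.
    - rewrite Hg0, Ec.
      replace (RtoC 4) with (2 * 2)%C
        by (unfold Cmult, RtoC; simpl; f_equal; ring).
      field; auto. }
  assert (H4 : RtoC 4 <> 0) by (apply RtoC_neq_0; lra).
  (* For radius [64 * |w|] the condition on the derivative reads
     [1 / (8 * |w|) + 4 < 1 / (4 * |w|)], that is, [|w| < 1 / 32]. *)
  destruct (large_derivative_omits_near_1 g (- / (4 * w)) (64 * Cmod w))
    as [u [Hu Hug]]; [exact Hgd'|exact Hg0|exact Hga| |lra| |].
  { intros z z' Hz Hz' E. apply (Hgn z); [unfold unit_disk in Hz; lra|].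
    assert (Eo : g z' = (- g z)%C)
      by (replace (g z') with ((g z + g z') - g z)%C by ring; rewrite E; ring).
    assert (Ezz : z = z') by (apply Hginj; auto; rewrite Eo; ring).
    subst z'. replace (g z) with ((g z - - g z) / 2)%C by (field; exact H2).
    rewrite <- Eo. field; exact H2. }
  { rewrite Cmod_opp, Cmod_inv by (apply Cmult_neq_0; assumption).
    rewrite Cmod_mult, Cmod_R, Rabs_pos_eq by lra.
    assert (Hi : 256 <= / Cmod w).
    { rewrite <- (Rinv_inv 256). apply Rinv_le_contravar; lra. }
    replace (8 / (64 * Cmod w)) with (/ 8 * / Cmod w) by (field; lra).
    replace (/ (4 * Cmod w)) with (/ 4 * / Cmod w) by (field; lra). lra. }
  (* The normalisation [(g - 1) / g' 0] and the image [w1] of [u] under it: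
     [|w1| <= 4 * |w| * 64 * |w| <= |w|]. *)
  exists (fun z => 4 * w + (- (4 * w)) * g z)%C, (- (4 * w) * (u - 1))%C.
  assert (H4w : (- (4 * w))%C <> 0).
  { apply Cmod_gt_0. rewrite Cmod_opp.
    apply Cmod_gt_0, Cmult_neq_0; assumption. }
  assert (M4 : Cmod (4 * w) = 4 * Cmod w)
    by (rewrite Cmod_mult, Cmod_R, Rabs_pos_eq by lra; reflexivity).
  split; [split; [|split; [|split]]|split; [|split]].
  - intros z Hz. destruct (Hgd' z Hz) as [l Hl]. eexists.
    apply Cis_derive_affine, Hl.
  - intros z z' Hz Hz' E. apply Hginj; auto.
    assert (Eg : g z = g z').
    { replace (g z) with ((4 * w + - (4 * w) * g z - 4 * w) / (- (4 * w)))%C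
        by (field; auto).
      rewrite E. field; auto. }
    rewrite Eg. reflexivity.
  - rewrite Hg0. ring.
  - eapply Cis_derive_eq; [apply Cis_derive_affine, Hga|]. field; auto.
  - intros z Hz.
    assert (Hz1 : Cmod z <= 1) by (unfold unit_disk in Hz; lra).
    eapply Rle_trans; [apply Cmod_triangle|].
    rewrite M4, Cmod_mult, Cmod_opp, M4.
    assert (HX : Cmod (g z) * Cmod (g z) <= 1 + M / Cmod w).
    { rewrite <- Cmod_mult, (proj2 (Hg z Hz1)). unfold h.
      eapply Rle_trans; [apply Cmod_triangle|].
      rewrite Cmod_1, Cmod_mult, Cmod_opp, Cmod_inv by exact Hw0.
      apply Rplus_le_compat_l. unfold Rdiv. rewrite Rmult_comm.
      apply Rmult_le_compat_r; [left; apply Rinv_0_lt_compat, Hwpos|].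
      apply HM, Hcin', Hz. }
    set (X := 4 * Cmod w * Cmod (g z)).
    assert (HX2 : X * X <= 16 * (Cmod w * Cmod w) + 16 * (M * Cmod w)).
    { unfold X.
      replace (16 * (Cmod w * Cmod w) + 16 * (M * Cmod w))
        with (16 * (Cmod w * Cmod w) * (1 + M / Cmod w)) by (field; lra).
      replace (4 * Cmod w * Cmod (g z) * (4 * Cmod w * Cmod (g z)))
        with (16 * (Cmod w * Cmod w) * (Cmod (g z) * Cmod (g z))) by ring.
      apply Rmult_le_compat_l; [|exact HX].
      pose proof (Rmult_lt_0_compat _ _ Hwpos Hwpos). lra. }
    assert (Hww : Cmod w * Cmod w <= / 256 * / 256)
      by (apply Rmult_le_compat; lra).
    assert (HMw : M * Cmod w <= M * / 256) by (apply Rmult_le_compat_l; lra).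
    assert (HMM : / 2 * M <= M * M) by (apply Rmult_le_compat_r; lra).
    (* [X * X <= M * M * (1/1024 + 1/8)], well below [(2/5 * M) ^ 2] *)
    assert (HX3 : X <= 2 / 5 * M).
    { apply Rnot_lt_le. intros L.
      assert (2 / 5 * M * (2 / 5 * M) < X * X)
        by (apply Rmult_le_0_lt_compat; lra).
      nra. }
    lra.
  - intros [z [Hz E]]. apply Hug. exists z. split; [exact Hz|].
    replace (g z) with ((4 * w + - (4 * w) * g z - 4 * w) / (- (4 * w)))%C
      by (field; auto).
    rewrite E. field; auto.
  - rewrite Cmod_mult, Cmod_opp, M4.
    assert (4 * Cmod w * Cmod (u - 1) <= 4 * Cmod w * (64 * Cmod w))
      by (apply Rmult_le_compat_l; lra).
    assert (Cmod w * Cmod w <= / 256 * / 256)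
      by (apply Rmult_le_compat; lra).
    lra.
Qed.

(** Each transform halves the bound, and [1 / 4] is too small to be a
    bound. *)
Lemma bounded_class_S_omitted (n : nat) : forall (f : C -> C) (w : C),
  class_S f -> (forall z, unit_disk z -> Cmod (f z) <= 2 ^ n / 4) ->
  ~ image f unit_disk w -> / 256 < Cmod w.
Proof.
  induction n as [|n IH]; intros f w Hf HM Hw; apply Rnot_le_lt; intros Hsmall.
  - pose proof (class_S_bound_ge_half f _ Hf HM). simpl in H. lra.
  - destruct (koebe_transform f _ w Hf HM Hw Hsmall)
      as [f1 [w1 [Hf1 [HM1 [Hw1 Hs1]]]]].
    apply (Rlt_not_le (Cmod w1) (/ 256)); [|exact Hs1].
    apply (IH f1 w1 Hf1); [|exact Hw1].
    intros z Hz. specialize (HM1 z Hz). simpl in HM1. lra.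
Qed.

(** Koebe's theorem with the constant [1 / 512] instead of [1 / 4].  Passing
    from [f] to [2 * f (z / 2)], which is bounded, doubles the omitted
    value. *)
Lemma image_contains_small_disk (f : C -> C) (w : C) :
  class_S f -> Cmod w < / 512 -> image f unit_disk w.
Proof.
  intros [Hd [Hinj [H0 H1]]] Hw. apply NNPP. intros Hno.
  set (c := RtoC (/ 2)).
  assert (H2 : RtoC 2 <> 0) by (apply RtoC_neq_0; lra).
  assert (Ec : c = (/ 2)%C) by (unfold c; apply RtoC_inv; lra).
  assert (Hc : forall z, Cmod (c * z) = Cmod z / 2) by (intros; apply Cmod_half).
  assert (Hcin : forall z, Cmod z <= 1 -> unit_disk (c * z))
    by (intros z Hz; unfold unit_disk; rewrite Hc; lra).
  assert (Hcin' : forall z, unit_disk z -> unit_disk (c * z))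
    by (intros z Hz; apply Hcin; unfold unit_disk in Hz; lra).
  set (F := fun z => (0 + 2 * f (c * z))%C).
  assert (HFd : forall z l, Cis_derive f (c * z)%C l ->
    Cis_derive F z (2 * (l * c))%C).
  { intros z l Hl.
    apply (Cis_derive_affine (fun z => f (c * z)%C)), Cis_derive_scal_arg, Hl. }
  assert (Hdiv : forall a b, (0 + 2 * a = b)%C -> a = (b / 2)%C)
    by (intros a b <-; field; exact H2).
  assert (HF : class_S F).
  { split; [|split; [|split]].
    - intros z Hz. destruct (Hd _ (Hcin' z Hz)) as [l Hl].
      eexists. apply HFd, Hl.
    - intros z z' Hz Hz' E.
      assert (Ef : f (c * z)%C = f (c * z')%C)
        by (apply Hdiv in E; rewrite E; unfold F; field; exact H2).
      apply Hinj in Ef; auto.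
      replace z with (2 * (c * z))%C by (rewrite Ec; field; exact H2).
      rewrite Ef, Ec. field; exact H2.
    - unfold F. rewrite Cmult_0_r, H0. ring.
    - eapply Cis_derive_eq; [apply HFd; rewrite Cmult_0_r; exact H1|].
      rewrite Ec. field; exact H2. }
  destruct (disc_bounded F) as [B [HB HFB]].
  { intros z Hz. destruct (Hd _ (Hcin z Hz)) as [l Hl].
    exact (Cis_derive_continuous F z _ (HFd z l Hl)). }
  destruct (Pow_x_infinity 2) with (b := 4 * B) as [n Hn];
    [rewrite Rabs_pos_eq; lra|].
  specialize (Hn n (le_n n)).
  assert (Hpow : 0 < 2 ^ n) by (apply pow_lt; lra).
  rewrite Rabs_pos_eq in Hn by lra.
  assert (L : / 256 < Cmod (2 * w)).
  { apply (bounded_class_S_omitted n F); [exact HF| |].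
    - intros z Hz. apply Rle_trans with B; [|lra].
      apply HFB. unfold unit_disk in Hz. lra.
    - intros [z [Hz E]]. apply Hno. exists (c * z)%C. split; [auto|].
      apply Hdiv in E. rewrite E. field; exact H2. }
  rewrite Cmod_mult, Cmod_R, Rabs_pos_eq in L by lra. lra.
Qed.

Theorem proposition5p1 :
  exists b : R, 1 < b /\
    forall f : C -> C, class_S f ->
      Rbar_le (Finite (1 / b)) (dist_to (RtoC 0) (boundary (image f unit_disk))) /\
      Rbar_le (dist_to (RtoC 0) (boundary (image f unit_disk))) (Finite 1).
Proof.
  exists 512. split; [lra|]. intros f Hf. unfold dist_to.
  match goal with |- context [Glb_Rbar ?E] =>
    destruct (Glb_Rbar_correct E) as [Hlb Hglb] end.
  split.
  - apply Hglb. intros r [w [Hw ->]].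
    replace (w - 0)%C with w by ring. simpl. apply Rnot_lt_le. intros L.
    destruct (Hw (fun u => Cmod u < / 512)) as [_ [u [Hu Hn]]].
    + apply Clocally_iff. exists (/ 512 - Cmod w). split; [lra|].
      intros u Hu. pose proof (Cmod_minus_le u w). lra.
    + apply Hn, image_contains_small_disk; assumption.
  - destruct (class_S_boundary_point f Hf) as [w [Hw Hle]].
    apply Rbar_le_trans with (Finite (Cmod (w - 0))).
    + apply Hlb. exists w. split; [exact Hw|reflexivity].
    + replace (w - 0)%C with w by ring. exact Hle.
Qed.
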